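(* Let $u>1$. There are constants $C$ and $c$ that may depend only on $u$ such that the following holds. Let $n$ be a positive integer and $p$ be such that $n^{-1/162}\le p\le 1-n^{-1}$. Let $A$ be a random subset of $\mathbb{Z}/n\mathbb{Z}$ constructed by keeping each element independently with probability $p$ and dropping it with probability $1-p$. Let $X$ be the number of pairs $(i,j)\in(\mathbb{Z}/n\mathbb{Z})^2$ such that $\{i,i+j,i+2j\}\subseteq A$. Define $$\theta_p(u):=\inf\biggl\{I_p(x):x\in[0,1]^{\mathbb{Z}/n\mathbb{Z}}\text{ such that }\sum_{i,j\in\mathbb{Z}/n\mathbb{Z}}x_ix_{i+j}x_{i+2j}\ge u\,\mathbb{E}(X)\biggr\}.$$ Then $$1-c\,n^{-1/6}p^{-6}\log n\le\frac{\theta_p(u)}{-\log\mathbb{P}(X\ge u\,\mathbb{E}(X))}\le1+C\,n^{-1/29}p^{-162/29}(\log n)^{33/29}.$$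
   Context: For $v\in[0,1]$, $I_p(v):=v\log\frac vp+(1-v)\log\frac{1-v}{1-p}$ (with $0\log0=0$), and for $x\in[0,1]^{\mathbb{Z}/n\mathbb{Z}}$, $I_p(x):=\sum_{i\in\mathbb{Z}/n\mathbb{Z}}I_p(x_i)$. Index arithmetic is modulo $n$. *)

(* Defs.v *)
From mathcomp Require Import all_boot all_order all_algebra.
From mathcomp Require Import all_classical all_reals all_analysis.

Set Implicit Arguments.
Unset Strict Implicit.
Unset Printing Implicit Defensive.

Import Order.TTheory GRing.Theory Num.Theory.
Local Open Scope ring_scope.

(* The group Z/nZ, for n = m.+1 >= 1, is 'I_m.+1 with its canonical zmodType
   structure (addition modulo m.+1).  ('Z_n is not used because 'Z_1 has two
   elements.) *)

Section ThreeAP.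
Context {R : realType} {m : nat}.
Implicit Types (p u : R) (x : 'I_m.+1 -> R) (A : {set 'I_m.+1}).

(* Product measure of m.+1 independent Bernoulli(p) membership indicators. *)
Definition subset_weight p A : R :=
  \prod_(i : 'I_m.+1) (if i \in A then p else 1 - p).

Definition Prob p (E : pred {set 'I_m.+1}) : R :=
  \sum_(A : {set 'I_m.+1} | E A) subset_weight p A.

Definition Expect p (f : {set 'I_m.+1} -> R) : R :=
  \sum_(A : {set 'I_m.+1}) subset_weight p A * f A.

Definition num_3ap A : nat :=
  #|[set ij : 'I_m.+1 * 'I_m.+1 |
      [set ij.1; ij.1 + ij.2; ij.1 + ij.2 *+ 2] \subset A]|.

Definition mean_3ap p : R := Expect p (fun A => (num_3ap A)%:R).

Definition prob_upper_tail p u : R :=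
  Prob p (fun A => u * mean_3ap p <= (num_3ap A)%:R).

(* ln 0 = 0 and 0 * y = 0, which gives the convention 0 log 0 = 0. *)
Definition rel_entropy p (v : R) : R :=
  v * ln (v / p) + (1 - v) * ln ((1 - v) / (1 - p)).

Definition rel_entropy_sum p x : R := \sum_(i : 'I_m.+1) rel_entropy p (x i).

Definition weighted_3ap x : R :=
  \sum_(i : 'I_m.+1) \sum_(j : 'I_m.+1) x i * x (i + j) * x (i + j *+ 2).

Definition feasible p u x : Prop :=
  (forall i, 0 <= x i <= 1) /\ u * mean_3ap p <= weighted_3ap x.

(* Extended-real valued, so that the infimum of the empty set is +oo. *)
Definition theta p u : \bar R :=
  ereal_inf [set (rel_entropy_sum p x)%:E | x in [set x | feasible p u x]]%classic.

End ThreeAP.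

(* Main.v *)
Require Import Defs.
From mathcomp Require Import all_boot all_order all_algebra.
From mathcomp Require Import all_classical all_reals all_analysis.
From mathcomp Require Import ring lra zify.

Import Order.TTheory GRing.Theory Num.Theory.
Local Open Scope ring_scope.

(* Let T(x) be the trilinear form counting weighted progressions, and say that
   two points are close if their difference h makes T(h, f, g), T(f, h, g) and
   T(f, g, h) all o(n^2), uniformly in f, g bounded by 1.

   Upper bound on the tail. By two Cauchy-Schwarz inequalities, closeness is
   controlled by the autocorrelations of h, and a second moment computation shows
   that 1_A is close to 1_(A :&: S) / q with probability at least 1/2 when S is a
   random set of density q = n^(-1/12). Hence the cube is covered by about
   exp(q n) classes on each of which T is nearly constant. The classes are convex,
   and a convex class B has probability at most exp(- inf_B I_p), since the
   conditional mean x of 1_A given B lies in B and P(B) <= exp(- I_p(x)).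

   Lower bound on the tail. Tilting to the product measure with marginals x makes
   the event likely, by Chebyshev's inequality, as soon as T(x) exceeds the target
   by n^(-2/5) n^2; the cost is I_p(x) + 1, by Gibbs' inequality.

   Both directions need that the infimum varies slowly with the target, which
   follows by moving x towards the constant 1, and that it is at least of order
   n p^6, which makes the errors relative. *)

(** * Relative entropy of a single Bernoulli variable *)

Section RelEntropy.
Context {R : realType}.
Implicit Types a b p v w l : R.

(** This is [ln y <= y - 1] at [y = b / a]; at [a = 0] the factor [a] kills the logarithm. *)
Lemma mul_ln_div_ge a b : 0 <= a -> 0 < b -> a - b <= a * ln (a / b).
Proof.
rewrite le0r => /orP[/eqP-> b0|a0 b0]; first by rewrite mul0r sub0r oppr_le0 ltW.
have h : ln (b / a) <= b / a - 1.
  rewrite -[X in ln X](addrNK 1) addrC; apply: le_ln1Dx.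
  by rewrite ltrBrDl subrr divr_gt0.
have -> : ln (a / b) = - ln (b / a).
  by rewrite -lnV ?posrE ?divr_gt0// invf_div.
rewrite mulrN lerNr opprB; apply: le_trans (ler_wpM2l (ltW a0) h) _.
by rewrite mulrBr mulr1 mulrCA mulfV ?mulr1// gt_eqF.
Qed.

Lemma mul_ln_div_split a b p : 0 <= a -> 0 < b -> 0 < p ->
  a * ln (a / p) = a * ln (a / b) + a * ln (b / p).
Proof.
rewrite le0r => /orP[/eqP-> *|a0 b0 p0]; first by rewrite !mul0r addr0.
by rewrite !ln_div ?posrE//; ring.
Qed.

Lemma rel_entropy1 p : 0 < p -> rel_entropy p 1 = - ln p.
Proof. by move=> p0; rewrite /rel_entropy subrr mul0r addr0 mul1r div1r lnV. Qed.

(** The bracket is affine in [v]: a change of reference measure alters the entropy by an affine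
    function only, which is the source of convexity. *)
Lemma rel_entropy_split p v w : 0 < p < 1 -> 0 <= v <= 1 -> 0 < w < 1 ->
  rel_entropy p v = rel_entropy w v
    + (v * ln (w / p) + (1 - v) * ln ((1 - w) / (1 - p))).
Proof.
move=> /andP[p0 p1] /andP[v0 v1] /andP[w0 w1]; rewrite /rel_entropy.
rewrite (@mul_ln_div_split v w p)// (@mul_ln_div_split (1 - v) (1 - w)) ?subr_ge0 ?subr_gt0//.
ring.
Qed.

Lemma rel_entropy_ge0 p v : 0 < p < 1 -> 0 <= v <= 1 -> 0 <= rel_entropy p v.
Proof.
move=> /andP[p0 p1] /andP[v0 v1]; rewrite /rel_entropy.
have := @mul_ln_div_ge v p v0 p0.
have := @mul_ln_div_ge (1 - v) (1 - p).
rewrite subr_ge0 subr_gt0 => /(_ v1 p1); lra.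
Qed.

(** With the mixture [w] as reference, the affine parts cancel and what remains is nonnegativity of
    [rel_entropy w] at [v] and at 1. Degenerate cases are split off first to ensure [0 < w < 1]. *)
Lemma rel_entropy_convex1 p v l : 0 < p < 1 -> 0 <= v <= 1 -> 0 <= l <= 1 ->
  rel_entropy p ((1 - l) * v + l) <= (1 - l) * rel_entropy p v + l * rel_entropy p 1.
Proof.
move=> p01 v01 /andP[l0 l1].
have [->|v1] := eqVneq v 1.
  by rewrite mulr1 addrNK -mulrDl addrNK mul1r.
have [->|ln1] := eqVneq l 1; first by rewrite subrr !mul0r add0r !mul1r add0r.
have [->|ln0] := eqVneq l 0; first by rewrite subr0 !mul1r addr0 mul0r addr0.
have {}l0 : 0 < l by rewrite lt_neqAle eq_sym ln0.
have {}l1 : l < 1 by rewrite lt_neqAle ln1.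
case/andP: v01 => v0; rewrite le_eqVlt (negbTE v1)/= => {}v1.
set w := (1 - l) * v + l.
have w01 : 0 < w < 1.
  rewrite /w; apply/andP; split.
    by apply: ltr_wpDl => //; apply: mulr_ge0 => //; rewrite subr_ge0 ltW.
  have : (1 - l) * v < (1 - l) * 1 by rewrite ltr_pM2l ?subr_gt0.
  by lra.
have v01 : 0 <= v <= 1 by rewrite v0 ltW.
have o01 : 0 <= (1 : R) <= 1 by rewrite ler01 lexx.
rewrite (rel_entropy_split _ v w p01 v01 w01) (rel_entropy_split _ 1 w p01 o01 w01).
have h1 := rel_entropy_ge0 _ _ w01 v01.
have h2 := rel_entropy_ge0 _ _ w01 o01.
rewrite /(rel_entropy p w) /=.
have -> : w * ln (w / p) + (1 - w) * ln ((1 - w) / (1 - p)) =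
  (1 - l) * (v * ln (w / p) + (1 - v) * ln ((1 - w) / (1 - p))) +
  l * (1 * ln (w / p) + (1 - 1) * ln ((1 - w) / (1 - p))) by rewrite {1 3}/w; ring.
have := mulr_ge0 (ltW l0) h2.
have : 0 <= (1 - l) * rel_entropy w v by rewrite mulr_ge0// subr_ge0 ltW.
move: (rel_entropy w v) (rel_entropy w 1) (ln (w / p)) (ln ((1 - w) / (1 - p))).
by move=> a b c d *; nra.
Qed.

(** The tangent inequality applied to square roots, since [ln (a / b)] is twice
    [ln (Num.sqrt a / Num.sqrt b)]. *)
Lemma mul_ln_div_ge_sqrt a b : 0 <= a -> 0 < b ->
  2 * a - 2 * Num.sqrt a * Num.sqrt b <= a * ln (a / b).
Proof.
move=> a0 b0; have sb : 0 < Num.sqrt b by rewrite sqrtr_gt0.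
have sa := sqrtr_ge0 a.
move: a0; rewrite le0r => /orP[/eqP->|a0].
  by rewrite sqrtr0 mulr0 mul0r mul0r subr0.
have {}sa : 0 < Num.sqrt a by rewrite sqrtr_gt0.
have := ler_wpM2l (ltW sa) (mul_ln_div_ge _ _ (ltW sa) sb).
have ea := sqr_sqrtr (ltW a0); have eb := sqr_sqrtr (ltW b0).
have -> : ln (a / b) = 2 * ln (Num.sqrt a / Num.sqrt b).
  by rewrite -[in LHS]ea -[in LHS]eb -expr_div_n lnXn ?divr_gt0// mulr_natl.
move: (ln _) => L h; rewrite -[in X in _ <= X]ea -[X in 2 * X - _]ea; nra.
Qed.

(** The entropy dominates [(Num.sqrt v - Num.sqrt p) ^+ 2], one half of the squared Hellinger
    distance; the 4 comes from [Num.sqrt v + Num.sqrt p <= 2]. *)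
Lemma rel_entropy_ge_sqr p v : 0 < p < 1 -> 0 <= v <= 1 ->
  (v - p) ^+ 2 / 4 <= rel_entropy p v.
Proof.
move=> /andP[p0 p1] /andP[v0 v1]; rewrite /rel_entropy.
have h1 := mul_ln_div_ge_sqrt _ _ v0 p0.
have h2 : 2 * (1 - v) - 2 * Num.sqrt (1 - v) * Num.sqrt (1 - p) <=
  (1 - v) * ln ((1 - v) / (1 - p)).
  by apply: mul_ln_div_ge_sqrt; rewrite ?subr_ge0 ?subr_gt0.
apply: le_trans (lerD h1 h2).
have h3 : 2 * Num.sqrt (1 - v) * Num.sqrt (1 - p) <= (1 - v) + (1 - p).
  have e1 : Num.sqrt (1 - v) ^+ 2 = 1 - v by rewrite sqr_sqrtr ?subr_ge0.
  have e2 : Num.sqrt (1 - p) ^+ 2 = 1 - p by rewrite sqr_sqrtr ?subr_ge0// ltW.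
  rewrite -[X in _ <= X + _]e1 -[X in _ <= _ + X]e2.
  have := sqr_ge0 (Num.sqrt (1 - v) - Num.sqrt (1 - p)); nra.
have ev := sqr_sqrtr v0; have ep := sqr_sqrtr (ltW p0).
have sv0 := sqrtr_ge0 v; have sp0 := sqrtr_ge0 p.
have sv1 : Num.sqrt v <= 1 by rewrite -sqrtr1 ler_wsqrtr.
have sp1 : Num.sqrt p <= 1 by rewrite -sqrtr1 ler_wsqrtr// ltW.
suff : (v - p) ^+ 2 / 4 <= (Num.sqrt v - Num.sqrt p) ^+ 2 by move: h3; rewrite !expr2; nra.
have -> : v - p = (Num.sqrt v - Num.sqrt p) * (Num.sqrt v + Num.sqrt p).
  by rewrite -[in LHS]ev -[in LHS]ep; ring.
rewrite exprMn -mulrA ler_piMr ?sqr_ge0//.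
rewrite ler_pdivrMr// mul1r; move: sv0 sp0 sv1 sp1; nra.
Qed.

(** The square root absorbs the infinite slope of [(1 - v) * ln (1 - v)] at [v = 1]. The term in
    [ln (1 - p)] has a favourable sign, so the bound does not degrade as [p] tends to 1. *)
Lemma rel_entropy_gap p v : 0 < p < 1 -> 0 <= v <= 1 ->
  rel_entropy p 1 - rel_entropy p v <= (3 - ln p) * Num.sqrt (1 - v).
Proof.
move=> /andP[p0 p1] /andP[v0 v1]; rewrite rel_entropy1//.
have q0 : 0 < 1 - p by rewrite subr_gt0.
have w0 : 0 <= 1 - v by rewrite subr_ge0.
rewrite /rel_entropy (mul_ln_div_split v 1 p)// (mul_ln_div_split (1 - v) 1 (1 - p))//.
have := @mul_ln_div_ge v 1 v0 ltr01.
have := mul_ln_div_ge_sqrt (1 - v) 1 w0 ltr01.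
rewrite sqrtr1 !div1r !divr1 !lnV ?posrE//.
have lp : ln p <= 0 by apply: ln_le0; exact: ltW.
have lq : ln (1 - p) <= 0 by apply: ln_le0; lra.
have lv : (1 - v) * ln (1 - p) <= 0 by rewrite mulr_ge0_le0.
have s1 : Num.sqrt (1 - v) <= 1 by rewrite -[leRHS]sqrtr1 ler_wsqrtr//; lra.
have ev := sqr_sqrtr w0; have s0 := sqrtr_ge0 (1 - v).
have sv : 1 - v <= Num.sqrt (1 - v) by rewrite -[leLHS]ev expr2 ler_piMl.
have : (1 - v) * - ln p <= Num.sqrt (1 - v) * - ln p by rewrite ler_wpM2r// oppr_ge0.
rewrite mulr1; move: lv sv; set s := Num.sqrt _; move: (ln p) (ln (1 - p)) (ln v) (ln (1 - v)) => *.
lra.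
Qed.

End RelEntropy.

(** * Product Bernoulli measures and change of measure *)

Section BernoulliWeight.
Context {R : realType} {I : finType}.
Implicit Types (x : I -> R) (A F : {set I}) (E : pred {set I}).

Definition bernoulli_weight x A : R :=
  \prod_(i : I) (if i \in A then x i else 1 - x i).

Lemma bernoulli_weight_ge0 x A :
  (forall i, 0 <= x i <= 1) -> 0 <= bernoulli_weight x A.
Proof.
move=> x01; apply: prodr_ge0 => i _; have /andP[x0 x1] := x01 i.
by case: ifP => // _; rewrite subr_ge0.
Qed.

(** Independence: expanding the product of sums chooses membership or its negation at every index,
    hence a set [A]. *)
Lemma expect_prod x (phi : I -> bool -> R) :
  \sum_A bernoulli_weight x A * \prod_i phi i (i \in A) =
  \prod_i (x i * phi i true + (1 - x i) * phi i false).
Proof.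
rewrite bigA_distr; apply: eq_bigr => A _.
by rewrite -big_split; apply: eq_bigr => i _; case: (i \in A).
Qed.

Lemma sum_bernoulli_weight x : \sum_A bernoulli_weight x A = 1.
Proof.
transitivity (\sum_A bernoulli_weight x A * \prod_(i : I) 1).
  by apply: eq_bigr => A _; rewrite big1// mulr1.
by rewrite (expect_prod x (fun _ _ => 1)) big1// => i _; ring.
Qed.

Lemma expect_coord x i (g : bool -> R) :
  \sum_A bernoulli_weight x A * g (i \in A) = x i * g true + (1 - x i) * g false.
Proof.
have := expect_prod x (fun k b => if k == i then g b else 1).
rewrite [RHS](bigD1 i)//= eqxx [X in _ = _ * X]big1 ?mulr1 => [<-|k /negbTE->]; last by ring.
apply: eq_bigr => A _; rewrite (bigD1 i)//= eqxx big1 ?mulr1// => k /negbTE->//.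
Qed.

Lemma expect_subset x F :
  \sum_A bernoulli_weight x A * (F \subset A)%:R = \prod_(i in F) x i.
Proof.
have := expect_prod x (fun k b => if k \in F then b%:R else 1).
rewrite [RHS](bigID (mem F))/= [X in _ = _ * X]big1 ?mulr1; last first.
  by move=> k /negbTE->; ring.
under [RHS]eq_bigr => k kF do rewrite kF mulr1 mulr0 addr0.
move=> <-; apply: eq_bigr => A _; congr (_ * _).
have [/fintype.subsetP FA|/subsetPn[k kF kA]] := boolP (F \subset A).
  by rewrite big1// => k _; case: ifP => // /FA ->.
by rewrite (bigD1 k)//= kF (negbTE kA) mul0r.
Qed.

Lemma ln_prod (f : I -> R) : (forall i, 0 < f i) ->
  ln (\prod_i f i) = \sum_i ln (f i).
Proof.
move=> f0; suff [] : ln (\prod_i f i) = \sum_i ln (f i) /\ 0 < \prod_i f i by [].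
apply: (big_rec2 (fun a b => ln a = b /\ 0 < a)); first by rewrite ln1.
by move=> i a b _ [<- a0]; rewrite lnM ?posrE// mulr_gt0.
Qed.

(** One coordinate's factor in the density of the product measure with marginals [x] against the one
    with constant marginal [p]. *)
Let ratio (p : R) x A i : R :=
  if i \in A then x i / p else (1 - x i) / (1 - p).

Let bernoulli_weight_ratio p x A : 0 < p < 1 ->
  bernoulli_weight x A =
  bernoulli_weight (fun=> p) A * \prod_i ratio p x A i.
Proof.
move=> /andP[p0 p1]; rewrite -big_split; apply: eq_bigr => i _ /=.
by rewrite /ratio; case: ifP => _; rewrite mulrC divfK// gt_eqF// subr_gt0.
Qed.

Let bernoulli_weight_gt0 (p : R) A :
  0 < p < 1 -> 0 < bernoulli_weight (fun=> p) A.
Proof.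
by move=> /andP[p0 p1]; apply: prodr_gt0 => i _; case: ifP; rewrite ?subr_gt0.
Qed.

(* If Q is the product measure with the marginals x of P( . | E), then
   1 >= Q(E) = P(E) E[dQ/dP | E], and Jensen's inequality bounds the last
   factor below by the exponential of the entropy of x. *)
Lemma prob_le_exp_entropy (p : R) E :
  let Z := \sum_(A | E A) bernoulli_weight (fun=> p) A in
  let x i := (\sum_(A | E A) bernoulli_weight (fun=> p) A * (i \in A)%:R) / Z in
  0 < p < 1 -> 0 < Z -> Z <= expR (- \sum_i rel_entropy p (x i)).
Proof.
move=> Z x p01 Z0; have /andP[p0 p1] := p01.
have w0 A := bernoulli_weight_gt0 p A p01.
have Zx i : \sum_(A | E A) bernoulli_weight (fun=> p) A * (i \in A)%:R = Z * x i.
  by rewrite mulrC divfK// gt_eqF.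
clearbody x.
have Zx' i : \sum_(A | E A) bernoulli_weight (fun=> p) A * (i \notin A)%:R =
    Z * (1 - x i).
  rewrite mulrBr mulr1 -Zx -sumrB; apply: eq_bigr => A _.
  by case: (i \in A); rewrite /= ?mulr1 ?mulr0 ?subr0 ?subrr.
have x0 i : 0 <= x i.
  by rewrite -(pmulr_rge0 _ Z0) -Zx sumr_ge0// => A _; rewrite mulr_ge0// ltW.
have x1 i : 0 <= 1 - x i.
  by rewrite -(pmulr_rge0 _ Z0) -Zx' sumr_ge0// => A _; rewrite mulr_ge0// ltW.
have r0 A i : E A -> 0 < ratio p x A i.
  move=> EA; rewrite /ratio; case: ifPn => iA; rewrite divr_gt0// ?subr_gt0//.
    rewrite -(pmulr_rgt0 _ Z0) -Zx (bigD1 A)//= iA mulr1 ltr_wpDr//.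
    by rewrite sumr_ge0// => B _; rewrite mulr_ge0// ltW.
  rewrite -subr_gt0 -(pmulr_rgt0 _ Z0) -Zx' (bigD1 A)//= iA mulr1 ltr_wpDr//.
  by rewrite sumr_ge0// => B _; rewrite mulr_ge0// ltW.
set h := \sum_i _.
suff : Z * expR h <= 1 by rewrite expRN -ler_pdivlMr ?expR_gt0// div1r.
(* Jensen in tangent form, [expR y >= expR h * (1 + (y - h))]: the linear term averages to 0 over
   [E], because [h] is the conditional mean of the log-density. *)
have -> : Z * expR h = \sum_(A | E A) bernoulli_weight (fun=> p) A *
    (expR h * (1 + (\sum_i ln (ratio p x A i) - h))).
  under eq_bigr do rewrite mulrCA mulrDr mulr1 mulrBr.
  rewrite -big_distrr/= big_split/= sumrB -big_distrl/=.
  suff -> : \sum_(A | E A) bernoulli_weight (fun=> p) A *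
    \sum_i ln (ratio p x A i) = Z * h by rewrite subrr addr0 mulrC.
  under eq_bigr do rewrite big_distrr/=.
  rewrite exchange_big/= big_distrr/=; apply: eq_bigr => i _.
  rewrite /rel_entropy mulrDr !mulrA -Zx -Zx' !big_distrl/= -big_split/=.
  apply: eq_bigr => A _; rewrite /ratio; case: (i \in A) => /=.
    by rewrite mulr1 mulr0 mul0r addr0.
  by rewrite mulr1 mulr0 mul0r add0r.
have x01 i : 0 <= x i <= 1 by rewrite x0 -subr_ge0 x1.
rewrite -[leRHS](sum_bernoulli_weight x) [leRHS](bigID E)/= -[leLHS]addr0 lerD//; last first.
  by apply: sumr_ge0 => A _; apply: bernoulli_weight_ge0.
apply: ler_sum => A EA; rewrite (bernoulli_weight_ratio p x A p01).
rewrite (ler_wpM2l (ltW (w0 A)))//.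
have pr0 : 0 < \prod_i ratio p x A i by apply: prodr_gt0 => i _; apply: r0.
rewrite -ln_prod => [|i]; last exact: r0.
rewrite -[leRHS]lnK ?posrE//; move: (ln _) => y.
have -> : expR y = expR (y - h) * expR h by rewrite -expRD subrK.
by rewrite mulrC ler_wpM2r ?expR_ge0// expR_ge1Dx.
Qed.

(* Gibbs' inequality against the density 1_E / P(E) + 1_(~ E). *)
Lemma prob_lower_bound (p : R) x E :
  let Z := \sum_(A | E A) bernoulli_weight (fun=> p) A in
  0 < p < 1 -> (forall i, 0 <= x i <= 1) -> 0 < Z ->
  (\sum_(A | E A) bernoulli_weight x A) * - ln Z <=
  \sum_i rel_entropy p (x i) + 1.
Proof.
move=> Z p01 x01 Z0; have /andP[p0 p1] := p01.
have w0 A := bernoulli_weight_gt0 p A p01.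
have wx0 A := bernoulli_weight_ge0 x A x01.
pose L A := \sum_i ln (ratio p x A i).
(* A vanishing ratio would break the logarithm of the product, but then the weight of [A] vanishes
   too and both sides are 0. *)
have LE A : bernoulli_weight x A * L A =
    bernoulli_weight x A * ln (bernoulli_weight x A / bernoulli_weight (fun=> p) A).
  have [->|wn0] := eqVneq (bernoulli_weight x A) 0; first by rewrite !mul0r.
  congr (_ * _); rewrite (bernoulli_weight_ratio p x A p01) mulrAC divff ?gt_eqF// mul1r.
  rewrite ln_prod// => i; rewrite lt_neqAle; apply/andP; split; last first.
    have /andP[xi0 xi1] := x01 i; rewrite /ratio.
    by case: ifP => _; rewrite divr_ge0// ?subr_ge0// ltW.
  move: wn0; rewrite (bernoulli_weight_ratio p x A p01) (bigD1 i)//=.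
  by apply: contraNneq => <-; rewrite mul0r mulr0.
have EL : \sum_A bernoulli_weight x A * L A = \sum_i rel_entropy p (x i).
  under eq_bigr do rewrite big_distrr/=.
  rewrite exchange_big/=; apply: eq_bigr => i _.
  by rewrite (expect_coord x i (fun b => ln (if b then x i / p else (1 - x i) / (1 - p)))).
rewrite -EL [X in _ <= X + 1](bigID E)/=.
(* The comparison measure has total mass 1 plus the probability of the complement of [E]; this
   excess is paid for by the [+ 1] of the conclusion. *)
have h1 : \sum_(A | E A) (bernoulli_weight x A - bernoulli_weight (fun=> p) A / Z) <=
  \sum_(A | E A) (bernoulli_weight x A * L A + bernoulli_weight x A * ln Z).
  apply: ler_sum => A _; rewrite LE.
  apply: le_trans (mul_ln_div_ge _ _ (wx0 A) (divr_gt0 (w0 A) Z0)) _.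
  have [->|wn0] := eqVneq (bernoulli_weight x A) 0; first by rewrite !mul0r addr0.
  have {}wx : 0 < bernoulli_weight x A by rewrite lt_neqAle eq_sym wn0 wx0.
  by rewrite !ln_div ?posrE ?divr_gt0// le_eqVlt; apply/orP; left; apply/eqP; ring.
have h2 : \sum_(A | ~~ E A) (bernoulli_weight x A - bernoulli_weight (fun=> p) A) <=
  \sum_(A | ~~ E A) (bernoulli_weight x A * L A).
  by apply: ler_sum => A _; rewrite LE; apply: mul_ln_div_ge.
have s1 := sum_bernoulli_weight x; have s2 := sum_bernoulli_weight (fun=> p).
move: s1 s2 h1 h2; rewrite (bigID E)/= => s1; rewrite (bigID E)/= -/Z => s2.
rewrite sumrB -big_distrl/= -/Z divff ?gt_eqF// big_split/= -big_distrl/= sumrB.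
by lra.
Qed.

End BernoulliWeight.

(** * The trilinear progression form and its control by autocorrelations *)

Section APForm.
Context {R : realType} {m : nat}.
Local Notation G := 'I_m.+1.
Local Notation n := (m.+1%:R : R).
Implicit Types (f g h : G -> R) (k : G) (c : R).

Lemma sqr_sum_le (I : finType) (b : I -> R) :
  (\sum_i b i) ^+ 2 <= #|I|%:R * \sum_i b i ^+ 2.
Proof.
have : 0 <= \sum_i \sum_j (b i - b j) ^+ 2.
  by apply: sumr_ge0 => i _; apply: sumr_ge0 => j _; apply: sqr_ge0.
have e i : \sum_j (b i - b j) ^+ 2 =
    #|I|%:R * b i ^+ 2 - 2 * b i * (\sum_j b j) + \sum_j b j ^+ 2.
  under eq_bigr do rewrite sqrrB.
  rewrite big_split/= sumrB sumr_const mulr_natl; congr (_ - _ + _).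
  by rewrite big_distrr/=; apply: eq_bigr => j _; rewrite mulr2n; ring.
under eq_bigr do rewrite e.
rewrite big_split/= sumrB sumr_const -big_distrr/= -big_distrl/= -big_distrr/=.
rewrite -mulr_natl expr2; lra.
Qed.

Lemma sqr_dotprod_le (f b : G -> R) c : (forall i, `|f i| <= c) ->
  (\sum_i f i * b i) ^+ 2 <= n * c ^+ 2 * \sum_i b i ^+ 2.
Proof.
move=> fc; apply: le_trans (sqr_sum_le _ _) _.
rewrite card_ord -mulrA ler_wpM2l// big_distrr/=; apply: ler_sum => i _.
rewrite exprMn ler_wpM2r ?sqr_ge0// -real_normK ?num_real//.
by rewrite lerXn2r// ?nnegrE// (le_trans _ (fc i)).
Qed.

Lemma sum_shift (F : G -> R) k : \sum_i F (i + k) = \sum_i F i.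
Proof. by rewrite [RHS](reindex_inj (addIr k)). Qed.

Lemma sum_shiftl (F : G -> R) k : \sum_i F (k + i) = \sum_i F i.
Proof. by rewrite [RHS](reindex_inj (addrI k)). Qed.

Lemma sum_opp (F : G -> R) : \sum_i F (- i) = \sum_i F i.
Proof. by rewrite [RHS](reindex_inj oppr_inj). Qed.

Definition ap_form f g h : R :=
  \sum_i \sum_j f i * g (i + j) * h (i + j *+ 2).

Lemma ap_form_left h f g :
  ap_form h f g = \sum_i h i * \sum_j f (i + j) * g (i + j *+ 2).
Proof.
by apply: eq_bigr => i _; rewrite big_distrr/=; under eq_bigr do rewrite -mulrA.
Qed.

(** Each progression is recentred at its middle term by shifting [i] by [- j]. *)
Lemma ap_form_mid h f g :
  ap_form f h g = \sum_i h i * \sum_j f (i - j) * g (i + j).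
Proof.
rewrite /ap_form exchange_big/=.
under eq_bigr => j _.
  rewrite -(sum_shift _ (- j)).
  under eq_bigr do rewrite addrNK mulr2n addrA addrNK.
  over.
rewrite exchange_big/=; apply: eq_bigr => i _; rewrite big_distrr/=.
by apply: eq_bigr => j _; ring.
Qed.

Lemma ap_form_sym f g h : ap_form f g h = ap_form h g f.
Proof.
rewrite !ap_form_mid; apply: eq_bigr => i _; congr (_ * _).
by rewrite -sum_opp; apply: eq_bigr => j _; rewrite opprK mulrC.
Qed.

Lemma ap_form_abs_sum f g h :
  (forall i, `|f i| <= 1) -> (forall i, `|g i| <= 1) ->
  `|ap_form h f g| <= n * \sum_i `|h i| /\ `|ap_form f h g| <= n * \sum_i `|h i|.
Proof.
move=> f1 g1.
have fg1 i j : `|f i * g j| <= 1 by rewrite normrM mulr_ile1.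
rewrite ap_form_left ap_form_mid.
by split; rewrite (le_trans (ler_norm_sum _ _ _))// big_distrr/=; apply: ler_sum => i _;
  rewrite normrM mulrC ler_wpM2r// (le_trans (ler_norm_sum _ _ _))//;
  rewrite (le_trans (ler_sum _ (fun j _ => fg1 _ _)))// sumr_const card_ord.
Qed.

Definition autocorr h k : R := \sum_i h i * h (i + k).

(** The first sum controls the middle slot of [ap_form], the second the outer slots. Neither
    replaces the other outright, as doubling is not injective when [m.+1] is even. *)
Definition autocorr_energy h : R :=
  \sum_k autocorr h k ^+ 2 + \sum_k autocorr h (k *+ 2) ^+ 2.

Lemma autocorr_norm_le f k : (forall i, `|f i| <= 1) -> `|autocorr f k| <= n.
Proof.
move=> f1; rewrite /autocorr (le_trans (ler_norm_sum _ _ _))//.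
rewrite (le_trans (ler_sum _ (G := fun=> 1) _))// => [i _|].
  by rewrite normrM mulr_ile1.
by rewrite sumr_const card_ord.
Qed.

(* Cauchy-Schwarz in the variables carrying g, then in those carrying f. *)
Lemma ap_form_left_pow4 h f g :
  (forall i, `|f i| <= 1) -> (forall i, `|g i| <= 1) ->
  ap_form h f g ^+ 4 <= n ^+ 5 * \sum_k autocorr h (k *+ 2) ^+ 2.
Proof.
move=> f1 g1; rewrite ap_form_sym.
have h1 : ap_form g f h ^+ 2 <=
    n * \sum_k autocorr f k * autocorr h (k *+ 2).
  rewrite ap_form_left (le_trans (sqr_dotprod_le _ _ 1 g1))//.
  rewrite expr1n mulr1 ler_wpM2l//.
  under eq_bigr do rewrite expr2 big_distrlr/=.
  rewrite exchange_big/=.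
  under eq_bigr => j _.
    (* With [w = i + j] the argument of [f] is free of [j]; once the second step is written [j + k],
       the sum over [j] is an autocorrelation of [h] at [k *+ 2]. *)
    rewrite -(sum_shift _ (- j)).
    under eq_bigr => i _.
      rewrite -(sum_shiftl _ j); over.
    over.
  rewrite exchange_big/= le_eqVlt; apply/orP; left; apply/eqP.
  under eq_bigr => w _.
    rewrite exchange_big/=.
    under eq_bigr => k _.
      have -> : \sum_(j : G) f (w - j + j) * h (w - j + j *+ 2) *
          (f (w - j + (j + k)) * h (w - j + (j + k) *+ 2)) =
        (f w * f (w + k)) * autocorr h (k *+ 2).
        rewrite /autocorr -[in RHS](sum_shiftl _ w) big_distrr/=; apply: eq_bigr => j _.
        by rewrite mulrnDl !addrA !addrNK; ring.
      over.
    over.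
  by rewrite exchange_big/=; apply: eq_bigr => k _; rewrite -big_distrl.
rewrite -[4%N]/(2 * 2)%N exprM (le_trans (_ : _ <= (n * \sum_k autocorr f k * autocorr h (k *+ 2)) ^+ 2))//.
  by rewrite lerXn2r// ?nnegrE ?sqr_ge0// (le_trans _ h1)// sqr_ge0.
rewrite exprMn -[5%N]/(2 + 3)%N exprD -mulrA ler_wpM2l ?sqr_ge0//.
apply: le_trans (sqr_dotprod_le _ _ n _) _ => [k|]; first exact: autocorr_norm_le.
by rewrite -exprS.
Qed.

(** Cauchy-Schwarz in the variable of [f], then in the difference [k] of two steps. Such a
    difference moves the middle term by [k] and the last by [k *+ 2], so here [h] is correlated at
    undoubled differences. *)
Lemma ap_form_mid_pow4 h f g :
  (forall i, `|f i| <= 1) -> (forall i, `|g i| <= 1) ->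
  ap_form f h g ^+ 4 <= n ^+ 5 * \sum_k autocorr h k ^+ 2.
Proof.
move=> f1 g1.
have h1 : ap_form f h g ^+ 2 <=
    n * \sum_k autocorr g (k *+ 2) * autocorr h k.
  rewrite ap_form_left (le_trans (sqr_dotprod_le _ _ 1 f1))//.
  rewrite expr1n mulr1 ler_wpM2l//.
  under eq_bigr do rewrite expr2 big_distrlr/=.
  rewrite exchange_big/= le_eqVlt; apply/orP; left; apply/eqP.
  under eq_bigr => j _.
    rewrite -(sum_shift _ (- (j *+ 2))).
    under eq_bigr => i _.
      rewrite -(sum_shiftl _ j); over.
    over.
  rewrite exchange_big/=.
  under eq_bigr => w _.
    rewrite exchange_big/=.
    under eq_bigr => k _.
      have -> : \sum_(j : G) h (w - j *+ 2 + j) * g (w - j *+ 2 + j *+ 2) *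
          (h (w - j *+ 2 + (j + k)) * g (w - j *+ 2 + (j + k) *+ 2)) =
        (g w * g (w + k *+ 2)) * autocorr h k.
        rewrite /autocorr -[in RHS](sum_shiftl _ w) -[in RHS]sum_opp big_distrr/=; apply: eq_bigr => j _.
        have ej : w - j *+ 2 + j = w - j by rewrite mulr2n opprD addrA addrNK.
        by rewrite mulrnDl !addrA ej addrNK; ring.
      over.
    over.
  by rewrite exchange_big/=; apply: eq_bigr => k _; rewrite -big_distrl.
rewrite -[4%N]/(2 * 2)%N exprM (le_trans (_ : _ <= (n * \sum_k autocorr g (k *+ 2) * autocorr h k) ^+ 2))//.
  by rewrite lerXn2r// ?nnegrE ?sqr_ge0// (le_trans _ h1)// sqr_ge0.
rewrite exprMn -[5%N]/(2 + 3)%N exprD -mulrA ler_wpM2l ?sqr_ge0//.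
apply: le_trans (sqr_dotprod_le _ _ n _) _ => [k|]; first exact: autocorr_norm_le.
by rewrite -exprS.
Qed.

End APForm.

(** * Approximation of a set by a random sample of it *)

Section RandomSampling.
Context {R : realType} {m : nat}.
Local Notation G := 'I_m.+1.
Local Notation n := (m.+1%:R : R).
Implicit Types (f g x y mu : G -> R) (A S : {set G}) (E : pred {set G}).
Implicit Types (d p q r : R).

Definition indicator A : G -> R := fun i => (i \in A)%:R.

(* h = 1_A - 1_(A :&: S) / q, whose entries are independent with mean 0 when
   S contains each point independently with probability q. *)
Definition sampling_error A q S : G -> R :=
  fun i => indicator A i - indicator (A :&: S) i / q.

Let entry A q (k : G) (b : bool) : R := (k \in A)%:R * (1 - b%:R / q).

Let sampling_errorE A q S k : sampling_error A q S k = entry A q k (k \in S).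
Proof.
by rewrite /sampling_error /indicator /entry inE; case: (k \in A); rewrite /= ?mul1r ?mul0r ?subrr.
Qed.

(** The entry at [a] is centred and independent of the other three. *)
Lemma expect_sampling_error4_eq0 A q (a b c d : G) : q != 0 -> a \notin [:: b; c; d] ->
  \sum_S bernoulli_weight (fun=> q) S *
    (sampling_error A q S a * sampling_error A q S b *
     (sampling_error A q S c * sampling_error A q S d)) = 0.
Proof.
move=> q0 abcd.
(* Collecting factors along the list with repetitions allows coincidences among [b], [c], [d]
   without case distinctions. *)
pose phi (i : G) (t : bool) :=
  \prod_(k <- [:: a; b; c; d]) (if i == k then entry A q k t else 1).
transitivity (\sum_S bernoulli_weight (fun=> q) S * \prod_i phi i (i \in S)).
  apply: eq_bigr => T _; congr (_ * _); rewrite /phi exchange_big/=.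
  have e k : \prod_(i : G) (if i == k then entry A q k (i \in T) else 1) =
      sampling_error A q T k.
    by rewrite (bigD1 k)//= eqxx big1 ?mulr1 ?sampling_errorE// => i /negbTE->.
  by rewrite !big_cons big_nil !e mulr1 !mulrA.
rewrite expect_prod (bigD1 a)//= /phi !big_cons !big_nil eqxx.
move: abcd; rewrite !inE !negb_or => /and3P[/negbTE-> /negbTE-> /negbTE->].
by rewrite !mulr1 /entry /= mul0r subr0 mulr1; field.
Qed.

Lemma sampling_error_norm_le A q S k : 0 < q <= 1 -> `|sampling_error A q S k| <= q^-1.
Proof.
move=> /andP[q0 q1]; rewrite sampling_errorE /entry.
have q2 : 1 <= q^-1 by rewrite invf_ge1.
have q3 : 0 < q^-1 by rewrite invr_gt0.
case: (k \in A) => /=; last by rewrite mul0r normr0 ltW.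
rewrite mul1r; case: (k \in S); rewrite /= ?mul0r ?subr0 ?normr1//.
by rewrite mul1r ler_norml; apply/andP; split; lra.
Qed.

Lemma expect_sampling_error4_le A q (a b c d : G) : 0 < q <= 1 ->
  \sum_S bernoulli_weight (fun=> q) S *
    (sampling_error A q S a * sampling_error A q S b *
     (sampling_error A q S c * sampling_error A q S d)) <=
  q^-1 ^+ 4 * (a \in [:: b; c; d])%:R.
Proof.
move=> q01; have [abcd|abcd] := boolP (a \in _); last first.
  by rewrite mulr0 expect_sampling_error4_eq0//; case/andP: q01 => /gt_eqF->.
rewrite mulr1 -[leRHS]mul1r -(sum_bernoulli_weight (fun _ : G => q)) big_distrl/=.
apply: ler_sum => S _; rewrite ler_wpM2l//.
  by apply: bernoulli_weight_ge0 => _; case/andP: q01 => /ltW-> ->.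
have h k := sampling_error_norm_le A q S k q01.
apply: le_trans (ler_norm _) _; rewrite !normrM -[4%N]/(1 + 1 + (1 + 1))%N !exprD !expr1.
by rewrite !ler_pM.
Qed.

Lemma sum_pair_eq (k : G) : \sum_(i : G) \sum_(j : G) (i == j + k)%:R = n.
Proof.
rewrite exchange_big/=.
under eq_bigr => j _.
  rewrite (bigD1 (j + k))//= eqxx big1 ?addr0 => [|i /negbTE->//].
  over.
by rewrite sumr_const card_ord.
Qed.

(** In the expanded square the index [i] must coincide with [i + k], [j] or [j + k], that is
    [k = 0], [i = j] or [i = j + k]; this gives the terms [n ^+ 2], [n] and [n]. *)
Lemma expect_autocorr_sqr A q (k : G) : 0 < q <= 1 ->
  \sum_S bernoulli_weight (fun=> q) S * autocorr (sampling_error A q S) k ^+ 2 <=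
  q^-1 ^+ 4 * (n ^+ 2 * (k == 0)%:R + 2 * n).
Proof.
move=> q01.
have -> : n ^+ 2 * (k == 0)%:R + 2 * n =
    \sum_(i : G) \sum_(j : G) ((k == 0)%:R + (i == j + 0)%:R + (i == j + k)%:R).
  under eq_bigr do rewrite !big_split/=.
  rewrite !big_split/= !sum_pair_eq !sumr_const card_ord.
  by rewrite -mulrnA -[(k == 0)%:R *+ _]mulr_natr natrM; ring.
rewrite big_distrr/=.
under eq_bigr do rewrite expr2 /autocorr big_distrlr/= big_distrr/=.
rewrite exchange_big/=; apply: ler_sum => i _.
under eq_bigr do rewrite big_distrr/=.
rewrite exchange_big/= big_distrr/=; apply: ler_sum => j _.
apply: le_trans (expect_sampling_error4_le _ _ _ _ _ _ q01) _.
rewrite ler_wpM2l ?exprn_ge0 ?invr_ge0//; first by case/andP: q01 => /ltW.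
rewrite !inE addr0 -[X in X == i + k]addr0 (inj_eq (addrI i)) (eq_sym 0).
by case: (k == 0); case: (i == j); case: (i == _); rewrite /= -?natrD ler_nat.
Qed.

(** Besides 0, only half the modulus can be a solution. *)
Lemma card_double_eq0 : (#|[set k : G | (k *+ 2 == 0)%R]| <= 2)%N.
Proof.
have /subset_leq_card/leq_trans-> // :
    [set k : G | k *+ 2 == 0] \subset [set 0; inord (m.+1)./2].
  apply/fintype.subsetP => k; rewrite !inE mulr2n => /eqP/(congr1 val)/= /eqP/dvdnP[c k2].
  have km := ltn_ord k.
  have [k0|k0] := eqVneq (nat_of_ord k) 0%N; first by apply/orP; left; apply/eqP/val_inj.
  apply/orP; right; apply/eqP/val_inj; rewrite /= inordK;
    case: c k2 => [|[|c]] k2; lia.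
by rewrite cards2; case: (_ != _).
Qed.

(** 7 is [(1 + 2) + (2 + 2)]: at most one [k] has [k = 0], at most two have [k *+ 2 = 0], and each
    sum adds 2 from the other coincidences. *)
Lemma expect_autocorr_energy A q : 0 < q <= 1 ->
  \sum_S bernoulli_weight (fun=> q) S * autocorr_energy (sampling_error A q S) <=
  7 * n ^+ 2 * q^-1 ^+ 4.
Proof.
move=> q01; have q40 : 0 <= q^-1 ^+ 4.
  by rewrite exprn_ge0// invr_ge0; case/andP: q01 => /ltW.
have h (D : G -> G) c : \sum_k (D k == 0)%:R <= c ->
    \sum_S bernoulli_weight (fun=> q) S *
      \sum_k autocorr (sampling_error A q S) (D k) ^+ 2 <= q^-1 ^+ 4 * (c + 2) * n ^+ 2.
  move=> Dc; under eq_bigr do rewrite big_distrr/=.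
  rewrite exchange_big/=.
  apply: le_trans (ler_sum _ (fun k _ => expect_autocorr_sqr A q (D k) q01)) _.
  rewrite -big_distrr/= -mulrA ler_wpM2l// big_split/= -big_distrr/=.
  rewrite sumr_const card_ord -[(2 * n) *+ _]mulr_natr.
  have -> : (c + 2) * n ^+ 2 = n ^+ 2 * c + 2 * n * n by ring.
  by rewrite lerD// ler_wpM2l// exprn_ge0.
under eq_bigr do rewrite mulrDr.
rewrite big_split/=.
have d1 : \sum_(k : G) (k == 0)%:R <= 1 :> R.
  by rewrite (bigD1 0)//= big1 ?addr0// => i /negbTE->.
have d2 : \sum_(k : G) (k *+ 2 == 0)%:R <= 2 :> R.
  rewrite -natr_sum ler_nat; apply: leq_trans card_double_eq0.
  by rewrite -sum1_card [leqRHS]big_mkcond/=; apply: leq_sum => i _; rewrite inE; case: eqP.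
apply: le_trans (lerD (h id 1 d1) (h (fun k => k *+ 2) 2 d2)) _.
by rewrite le_eqVlt; apply/orP; left; apply/eqP; ring.
Qed.

(* Convex in x. The third slot of ap_form is covered by ap_form_sym. *)
Definition ap_close mu d x : Prop := forall f g,
  (forall i, `|f i| <= 1) -> (forall i, `|g i| <= 1) ->
  `|ap_form (fun i => x i - mu i) f g| <= d /\
  `|ap_form f (fun i => x i - mu i) g| <= d.

Lemma norm_le_pow4 (a b : R) : 0 <= b -> a ^+ 4 <= b ^+ 4 -> `|a| <= b.
Proof.
move=> b0; rewrite -[4%N]/(2 * 2)%N !exprM.
rewrite ler_sqr ?nnegrE ?sqr_ge0// => ab.
by rewrite -(ger0_norm b0) -ler_sqr ?nnegrE// !real_normK ?num_real.
Qed.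

(** Markov's inequality at twice the mean of the energy, followed by the fourth-power bounds on
    [ap_form]. *)
Lemma ap_close_sampling A q r : 0 < q <= 1 -> 0 <= r -> 1 <= r ^+ 4 * n * q ^+ 4 ->
  2^-1 <= \sum_(S | `[< ap_close (fun i => indicator (A :&: S) i / q) (2 * n ^+ 2 * r)
                         (indicator A) >]) bernoulli_weight (fun=> q) S.
Proof.
move=> q01 r0 rq; have /andP[q0 q1] := q01.
have w0 S : 0 <= bernoulli_weight (fun _ : G => q) S.
  by apply: bernoulli_weight_ge0 => _; rewrite q1 ltW.
pose U S := autocorr_energy (sampling_error A q S).
have U0 S : 0 <= U S by rewrite addr_ge0// sumr_ge0// => k _; apply: sqr_ge0.
pose c := 14 * n ^+ 2 * q^-1 ^+ 4.
have c0 : 0 < c by rewrite !mulr_gt0// ?exprn_gt0 ?invr_gt0.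
have hU : \sum_(S | ~~ (U S <= c)) bernoulli_weight (fun _ : G => q) S <= 2^-1.
  rewrite -(ler_pM2r c0); have -> : 2^-1 * c = 7 * n ^+ 2 * q^-1 ^+ 4.
    by rewrite /c; field; rewrite gt_eqF.
  apply: le_trans (expect_autocorr_energy A q q01).
  rewrite [leRHS](bigID (fun S => U S <= c))/= ler_wpDl ?sumr_ge0//.
    by move=> S _; rewrite mulr_ge0// ?w0 ?U0.
  rewrite big_distrl/=; apply: ler_sum => S; rewrite -ltNge => /ltW h.
  by rewrite ler_wpM2l// w0.
have : 2^-1 <= \sum_(S | U S <= c) bernoulli_weight (fun _ : G => q) S.
  have := sum_bernoulli_weight (fun _ : G => q).
  by rewrite (bigID (fun S => U S <= c))/= => s1; lra.
move/le_trans; apply.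
rewrite big_mkcond [leRHS]big_mkcond/=; apply: ler_sum => S _.
case: ifP => [Uc|_]; last by case: ifP.
suff -> : `[< ap_close (fun i => indicator (A :&: S) i / q) (2 * n ^+ 2 * r)
  (indicator A) >] by [].
apply/asboolP => f g f1 g1.
(* The fourth power of 2 is 16, which leaves room for the 14 in [c]. *)
have key : n ^+ 5 * c <= (2 * n ^+ 2 * r) ^+ 4.
  have -> : (2 * n ^+ 2 * r) ^+ 4 = n ^+ 5 * (16 * n ^+ 2 * q^-1 ^+ 4 * (r ^+ 4 * n * q ^+ 4)).
    by field; rewrite gt_eqF.
  rewrite ler_wpM2l ?exprn_ge0//.
  apply: (@le_trans _ _ (16 * n ^+ 2 * q^-1 ^+ 4 * 1)).
    by rewrite mulr1 /c !ler_wpM2r ?exprn_ge0 ?invr_ge0 ?ler_nat// ltW.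
  by rewrite ler_wpM2l// !mulr_ge0// ?exprn_ge0 ?invr_ge0// ltW.
have d0 : 0 <= 2 * n ^+ 2 * r by rewrite !mulr_ge0.
have sq0 (D : G -> G) : 0 <= \sum_k autocorr (sampling_error A q S) (D k) ^+ 2.
  by apply: sumr_ge0 => k _; apply: sqr_ge0.
split; apply: norm_le_pow4 => //; apply: le_trans key.
  apply: le_trans (ap_form_left_pow4 _ _ _ f1 g1) _; rewrite ler_wpM2l ?exprn_ge0//.
  by apply: le_trans Uc; rewrite lerDr (sq0 id).
apply: le_trans (ap_form_mid_pow4 _ _ _ f1 g1) _; rewrite ler_wpM2l ?exprn_ge0//.
by apply: le_trans Uc; rewrite lerDl (sq0 (fun k => k *+ 2)).
Qed.

End RandomSampling.

(** * Union bound over a random cover, and stability of the form on a class *)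

Section RandomCover.
Context {R : realType}.

(* The union bound runs over the subsets T = A :&: S of S only, so averaging
   over S costs E[2^#|S|] = (1 + q)^#|I|. *)
Lemma random_cover_bound (I : finType) (P : {set I} -> R) (q M : R)
    (C : {set I} -> pred {set I}) (E : pred {set I}) :
  (forall A, 0 <= P A) -> 0 <= q <= 1 ->
  (forall A, 2^-1 <= \sum_(S | C (A :&: S) A) bernoulli_weight (fun=> q) S) ->
  (forall S, \sum_(A | E A && C S A) P A <= M) ->
  \sum_(A | E A) P A <= 2 * (1 + q) ^+ #|I| * M.
Proof.
move=> P0 q01 hC hM.
have w0 S : 0 <= bernoulli_weight (fun _ : I => q) S by apply: bernoulli_weight_ge0.
have -> : (1 + q) ^+ #|I| =
    \sum_S bernoulli_weight (fun _ : I => q) S * #|powerset S|%:R.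
  have := expect_prod (fun _ : I => q) (fun _ b => if b then 2 else 1).
  rewrite [RHS](eq_bigr (fun=> 1 + q)) => [|i _]; last by ring.
  rewrite prodr_const => <-; apply: eq_bigr => S _; congr (_ * _).
  by rewrite -big_mkcond/= prodr_const card_powerset natrX.
have hS S : \sum_(A | E A && C (A :&: S) A) P A <= #|powerset S|%:R * M.
  apply: (@le_trans _ _ (\sum_(T in powerset S) \sum_(A | E A && C T A) P A)).
    rewrite [leLHS]big_mkcondr/= [leRHS](eq_bigr (fun T => \sum_(A | E A) if C T A then P A else 0)).
      rewrite exchange_big/=; apply: ler_sum => A EA.
      rewrite (bigD1 (A :&: S)) ?powersetE ?subsetIr//= lerDl sumr_ge0// => T _.
      by case: ifP.
    by move=> T _; rewrite big_mkcondr.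
  by rewrite mulr_natl -sumr_const; apply: ler_sum.
apply: (@le_trans _ _ (\sum_(A | E A) P A *
    (2 * \sum_(S | C (A :&: S) A) bernoulli_weight (fun=> q) S))).
  by apply: ler_sum => A _; rewrite ler_peMr//; have := hC A; lra.
under eq_bigr do rewrite mulrCA big_distrr/= big_mkcond/=.
rewrite -big_distrr/= -mulrA ler_wpM2l// exchange_big/= big_distrl/=.
apply: ler_sum => S _; rewrite -mulrA.
apply: le_trans (ler_wpM2l (w0 S) (hS S)).
rewrite big_distrr/= [leRHS]big_mkcondr/=; apply: ler_sum => A _.
by case: ifP => // _; rewrite mulrC.
Qed.

Context {m : nat}.
Local Notation G := 'I_m.+1.
Local Notation n := (m.+1%:R : R).
Implicit Types (f g x y mu : G -> R) (A S : {set G}) (E : pred {set G}).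
Implicit Types (d p q r : R).

Lemma ap_form_ext f f' g g' h h' : f =1 f' -> g =1 g' -> h =1 h' ->
  ap_form f g h = ap_form f' g' h' :> R.
Proof.
by move=> ef eg eh; apply: eq_bigr => i _; apply: eq_bigr => j _; rewrite ef eg eh.
Qed.

Lemma ap_formB_left x y f g :
  ap_form (fun i => x i - y i) f g = ap_form x f g - ap_form y f g.
Proof. by rewrite !ap_form_left -sumrB; apply: eq_bigr => i _; rewrite mulrBl. Qed.

Lemma ap_formB_mid x y f g :
  ap_form f (fun i => x i - y i) g = ap_form f x g - ap_form f y g.
Proof. by rewrite !ap_form_mid -sumrB; apply: eq_bigr => i _; rewrite mulrBl. Qed.

(** One slot is changed at a time; reversal moves the difference from the third slot to the first,
    so only two slots need control. *)
Lemma ap_form_telescope x y :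
  ap_form x x x - ap_form y y y = ap_form (fun i => x i - y i) x x +
    ap_form y (fun i => x i - y i) x + ap_form (fun i => x i - y i) y y.
Proof.
by rewrite !ap_formB_left ap_formB_mid (ap_form_sym y y x); ring.
Qed.

Lemma norm_le1 x : (forall i, 0 <= x i <= 1) -> forall i, `|x i| <= 1.
Proof. by move=> x01 i; have /andP[x0 x1] := x01 i; rewrite ger0_norm. Qed.

(** Three slots, each costing [2 * d] by the triangle inequality through [mu]. *)
Lemma ap_form_close mu d x y : (forall i, 0 <= x i <= 1) -> (forall i, 0 <= y i <= 1) ->
  ap_close mu d x -> ap_close mu d y -> `|ap_form x x x - ap_form y y y| <= 6 * d.
Proof.
move=> x01 y01 cx cy; rewrite ap_form_telescope.
have x1 := norm_le1 x x01; have y1 := norm_le1 y y01.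
have key f g : (forall i, `|f i| <= 1) -> (forall i, `|g i| <= 1) ->
    `|ap_form (fun i => x i - y i) f g| <= 2 * d /\
    `|ap_form f (fun i => x i - y i) g| <= 2 * d.
  move=> f1 g1; have [a1 a2] := cx f g f1 g1; have [b1 b2] := cy f g f1 g1.
  move: a1 a2 b1 b2; rewrite !ap_formB_left !ap_formB_mid => a1 a2 b1 b2.
  split; rewrite (le_trans _ (_ : d + d <= _)) ?(mulr_natl d 2)//.
    by rewrite (le_trans (ler_distD (ap_form mu f g) _ _))// lerD// distrC.
  by rewrite (le_trans (ler_distD (ap_form f mu g) _ _))// lerD// distrC.
have [k1 _] := key x x x1 x1; have [_ k2] := key y x y1 x1.
have [k3 _] := key y y y1 y1.
rewrite (le_trans (ler_normD _ _))//.
apply: le_trans (lerD (le_trans (ler_normD _ _) (lerD k1 k2)) k3) _.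
by lra.
Qed.

Lemma ap_form_lipschitz x y : (forall i, 0 <= x i <= 1) -> (forall i, 0 <= y i <= 1) ->
  ap_form x x x - ap_form y y y <= 3 * n * \sum_i `|x i - y i|.
Proof.
move=> x01 y01; have x1 := norm_le1 x x01; have y1 := norm_le1 y y01.
rewrite ap_form_telescope; set h := fun i => x i - y i.
have [k1 _] := ap_form_abs_sum x x h x1 x1; have [_ k2] := ap_form_abs_sum y x h y1 x1.
have [k3 _] := ap_form_abs_sum y y h y1 y1.
apply: le_trans (lerD (lerD (le_trans (ler_norm _) k1) (le_trans (ler_norm _) k2))
  (le_trans (ler_norm _) k3)) _.
by rewrite le_eqVlt; apply/orP; left; apply/eqP; ring.
Qed.

(** For fixed [f] and [g] closeness bounds affine functions of the point, and these commute with
    averaging. *)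
Lemma ap_close_average (c : {set G} -> R) E mu d x :
  (forall A, 0 <= c A) -> \sum_(A | E A) c A = 1 ->
  (forall A, E A -> ap_close mu d (indicator A)) ->
  (forall i, x i = \sum_(A | E A) c A * indicator A i) -> ap_close mu d x.
Proof.
move=> c0 c1 cl xE f g f1 g1.
have avg (K : G -> R) : \sum_i (x i - mu i) * K i =
    \sum_(A | E A) c A * \sum_i (indicator A i - mu i) * K i.
  under [RHS]eq_bigr do rewrite big_distrr/=.
  rewrite exchange_big/=; apply: eq_bigr => i _.
  rewrite xE -[mu i in LHS]mul1r -c1 big_distrl/= -sumrB big_distrl/=.
  by apply: eq_bigr => A _; ring.
have le_avg (K : {set G} -> R) : (forall A, E A -> `|K A| <= d) ->
    `|\sum_(A | E A) c A * K A| <= d.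
  move=> Kd; rewrite (le_trans (ler_norm_sum _ _ _))// -[leRHS]mul1r -c1 big_distrl/=.
  by apply: ler_sum => A EA; rewrite normrM ger0_norm// ler_wpM2l// Kd.
rewrite ap_form_left ap_form_mid !avg; split; apply: le_avg => A EA.
  by rewrite -ap_form_left; have [] := cl A EA f g f1 g1.
by rewrite -ap_form_mid; have [] := cl A EA f g f1 g1.
Qed.

Lemma indicator01 A i : 0 <= (indicator A i : R) <= 1.
Proof. by rewrite /indicator ler0n lern1; case: (_ \in _). Qed.

(** The witness is the conditional mean of the indicator given [E]. Averaging keeps it close to
    [mu], so its form is within [6 * d] of that of any member of [E]. *)
Lemma close_class_bound p E mu d t :
  let Z := \sum_(A | E A) bernoulli_weight (fun=> p) A in
  0 < p < 1 -> 0 < Z ->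
  (forall A, E A -> ap_close mu d (indicator A)) ->
  (forall A, E A -> t <= ap_form (indicator A) (indicator A) (indicator A)) ->
  exists x, [/\ forall i, 0 <= x i <= 1, t - 6 * d <= ap_form x x x &
    Z <= expR (- \sum_i rel_entropy p (x i))].
Proof.
move=> Z p01 Z0 cl ht.
have w0 A : 0 <= bernoulli_weight (fun _ : G => p) A.
  by apply: bernoulli_weight_ge0 => _; case/andP: p01 => /ltW-> /ltW->.
pose x i := (\sum_(A | E A) bernoulli_weight (fun=> p) A * (i \in A)%:R) / Z.
have x01 i : 0 <= x i <= 1.
  apply/andP; split.
    by apply: divr_ge0; [apply: sumr_ge0 => A _; apply: mulr_ge0|exact: ltW].
  rewrite ler_pdivrMr// mul1r; apply: ler_sum => A _; rewrite ler_piMr//.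
  by rewrite lern1; case: (_ \in _).
exists x; split => //; last exact: prob_le_exp_entropy.
have [A EA] : exists A, E A.
  have [A EA|noE] := pickP E; first by exists A.
  by move: Z0; rewrite /Z big_pred0 ?ltxx.
have clx : ap_close mu d x.
  apply: (ap_close_average (fun A => bernoulli_weight (fun=> p) A / Z) E) => //.
  - by move=> B; rewrite divr_ge0// ltW.
  - by rewrite -big_distrl/= divff// gt_eqF.
  - by move=> i; rewrite /x big_distrl/=; apply: eq_bigr => B _; rewrite mulrAC.
have := ap_form_close _ _ _ _ x01 (indicator01 A) clx (cl A EA).
have := ht A EA; rewrite ler_norml => h /andP[h' _]; lra.
Qed.

End RandomCover.

(** * Raising the form at a small cost in entropy *)

Section Boost.
Context {R : realType} {m : nat}.
Local Notation G := 'I_m.+1.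
Local Notation n := (m.+1%:R : R).
Implicit Types (x y : G -> R) (A : {set G}) (p l D t : R).

Lemma sum_le_card x : (forall i, 0 <= x i <= 1) -> \sum_i x i <= n.
Proof.
move=> x01; apply: le_trans (ler_sum _ (G := fun=> 1) _) _ => [i _|].
  by case/andP: (x01 i).
by rewrite sumr_const card_ord.
Qed.

Lemma ap_form_le_sqr x : (forall i, 0 <= x i <= 1) ->
  ap_form x x x <= (\sum_i x i) ^+ 2.
Proof.
move=> x01; rewrite expr2 big_distrl/=; apply: ler_sum => i _.
rewrite -[X in _ <= _ * X](sum_shiftl _ i) big_distrr/=; apply: ler_sum => j _.
have /andP[a0 _] := x01 i; have /andP[b0 _] := x01 (i + j).
by have /andP[_ c1] := x01 (i + j *+ 2); rewrite ler_piMr// mulr_ge0.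
Qed.

(** Termwise expansion in powers of [l]: the sum of pairwise products is bounded below by
    [3 * (a * b * c)] and the cubic term by [l ^+ 3 * (a * b * c)]; the gain comes from
    [(1 - l) * l ^+ 2 * (a + b + c)]. *)
Lemma ap_form_mix1 x y l : (forall i, 0 <= x i <= 1) -> 0 <= l <= 1 ->
  (forall i, y i = (1 - l) * x i + l) ->
  ap_form x x x + 3 * (1 - l) * l ^+ 2 * (n * \sum_i x i - ap_form x x x) <=
  ap_form y y y.
Proof.
move=> x01 /andP[l0 l1] yE.
have e1 : n * \sum_i x i = \sum_(i : G) \sum_(j : G) x i.
  by under [RHS]eq_bigr do rewrite sumr_const card_ord -mulr_natl; rewrite -big_distrr.
have e2 : n * \sum_i x i = \sum_(i : G) \sum_(j : G) x (i + j).
  by under [RHS]eq_bigr do rewrite sum_shiftl; rewrite sumr_const card_ord mulr_natl.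
have e3 : n * \sum_i x i = \sum_(i : G) \sum_(j : G) x (i + j *+ 2).
  rewrite exchange_big/=; under [RHS]eq_bigr do rewrite sum_shift.
  by rewrite sumr_const card_ord mulr_natl.
have -> : ap_form x x x + 3 * (1 - l) * l ^+ 2 * (n * \sum_i x i - ap_form x x x) =
  (1 - 3 * (1 - l) * l ^+ 2) * ap_form x x x + (1 - l) * l ^+ 2 *
  (n * \sum_i x i + n * \sum_i x i + n * \sum_i x i) by ring.
rewrite {1}e1 {1}e2 e3 /ap_form !big_distrr/= -!big_split/= big_distrr/= -big_split/=.
apply: ler_sum => i _; rewrite -!big_split/= !big_distrr/= -big_split/=.
apply: ler_sum => j _; rewrite !yE.
have := x01 i; have := x01 (i + j); have := x01 (i + j *+ 2).
move: (x i) (x (i + j)) (x (i + j *+ 2)) => a b c.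
move=> /andP[c0 c1] /andP[b0 b1] /andP[a0 a1].
have k0 : 0 <= 1 - l by rewrite subr_ge0.
have abc : a * b * c <= 1 by rewrite !mulr_ile1 ?mulr_ge0.
have ab : a * b * c <= a * b by rewrite ler_piMr ?mulr_ge0.
have ac : a * b * c <= a * c by rewrite mulrAC ler_piMr ?mulr_ge0.
have bc : a * b * c <= b * c by rewrite -mulrA ler_piMl ?mulr_ge0.
have h1 : 0 <= (1 - l) ^+ 2 * l * (a * b + a * c + b * c - 3 * (a * b * c)).
  by rewrite mulr_ge0// ?mulr_ge0 ?exprn_ge0//; lra.
have h2 : 0 <= l ^+ 3 * (1 - a * b * c) by rewrite mulr_ge0 ?exprn_ge0// subr_ge0.
rewrite -subr_ge0; apply: le_trans (addr_ge0 h1 h2) _.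
by rewrite le_eqVlt; apply/orP; left; apply/eqP; ring.
Qed.

Lemma ap_form_le_sum x : (forall i, 0 <= x i <= 1) ->
  ap_form x x x <= n * \sum_i x i.
Proof.
move=> x01; apply: le_trans (ap_form_le_sqr _ x01) _.
rewrite expr2 ler_wpM2r ?sumr_ge0// => [i _|]; first by case/andP: (x01 i).
exact: sum_le_card.
Qed.

Lemma ap_form_le_card x : (forall i, 0 <= x i <= 1) -> ap_form x x x <= n ^+ 2.
Proof.
move=> x01; apply: le_trans (ap_form_le_sum _ x01) _.
by rewrite expr2 ler_wpM2l// sum_le_card.
Qed.

(* With s = (\sum_i x i) / n the left side is at least n^2 s (1 - s), and also
   n^2 (s - 1) + (n^2 - ap_form x x x). *)
Lemma ap_form_defect x D : (forall i, 0 <= x i <= 1) ->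
  0 <= D -> D * n ^+ 2 <= ap_form x x x ->
  D * (n ^+ 2 - ap_form x x x) <= 2 * (n * \sum_i x i - ap_form x x x).
Proof.
move=> x01 D0; have := ap_form_le_sqr _ x01; have := ap_form_le_sum _ x01.
have := sum_le_card x x01.
have : 0 <= \sum_i x i by rewrite sumr_ge0// => i _; case/andP: (x01 i).
have : 0 < n by rewrite ltr0n.
move: (ap_form x x x) (\sum_i x i) => T S; move: n => N.
move=> N0 S0 SN TS TS2 DT.
have DS : D * N <= S.
  rewrite -(ler_pM2r N0); apply: le_trans (_ : T <= _); last by rewrite mulrC.
  by rewrite -mulrA -expr2.
have D1 : D <= 1.
  by rewrite -(ler_pM2r N0) mul1r (le_trans DS).
(* Either the deficit [N ^+ 2 - T] is at most twice [N * (N - S)], and [D * N <= S] applies, or at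
   least half of it survives the subtraction of [N * (N - S)]. *)
have [h|h] := leP (N ^+ 2 - T) (2 * N * (N - S)).
  have h1 := ler_wpM2l D0 h; apply: le_trans h1 _.
  have h2 : D * N * (N - S) <= S * (N - S) by rewrite ler_wpM2r// subr_ge0.
  move: h2 TS2; rewrite expr2; nra.
have h1 : D * (N ^+ 2 - T) <= 1 * (N ^+ 2 - T).
  by rewrite ler_wpM2r//; move: h; have := mulr_ge0 (ltW N0) (_ : 0 <= N - S);
    rewrite subr_ge0 => /(_ SN); lra.
apply: le_trans h1 _; move: h; rewrite expr2; lra.
Qed.

(** The coordinatewise gap, with Cauchy-Schwarz moving the sum under the square root. *)
Lemma entropy_gap_sum p x : 0 < p < 1 -> (forall i, 0 <= x i <= 1) ->
  \sum_(i : G) rel_entropy p 1 - \sum_i rel_entropy p (x i) <=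
  (3 - ln p) * Num.sqrt (n ^+ 2 - ap_form x x x).
Proof.
move=> p01 x01; have /andP[p0 p1] := p01.
rewrite -sumrB; apply: le_trans (ler_sum _ (fun i _ => rel_entropy_gap _ _ p01 (x01 i))) _.
have lp : ln p <= 0 by apply: ln_le0; apply: ltW.
rewrite -big_distrr/= ler_wpM2l//; first by lra.
have s0 : 0 <= \sum_i Num.sqrt (1 - x i) by apply: sumr_ge0 => i _; apply: sqrtr_ge0.
rewrite -[leLHS](ger0_norm s0) -sqrtr_sqr ler_wsqrtr//.
apply: le_trans (sqr_sum_le _ _) _.
rewrite card_ord (eq_bigr (fun i => 1 - x i)); last first.
  by move=> i _; rewrite sqr_sqrtr// subr_ge0; case/andP: (x01 i).
rewrite sumrB sumr_const card_ord mulrBr -expr2 lerD2l lerN2.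
exact: ap_form_le_sum.
Qed.

(* Take y = (1 - l) x + l and tau = n^2 - ap_form x x x. The form gains at
   least a constant times l^2 t tau, and by convexity the entropy grows by at
   most l times its gap to the constant point 1, which is O(sqrt tau): the two
   powers of tau cancel, so nothing is lost when ap_form x x x is near n^2. *)
Lemma boost p x t D : 0 < p < 1 -> (forall i, 0 <= x i <= 1) ->
  0 < t -> t * n ^+ 2 <= ap_form x x x -> 0 <= D ->
  exists y, [/\ forall i, 0 <= y i <= 1,
    ap_form x x x + D * n ^+ 2 <= ap_form y y y \/ y = (fun=> 1) &
    \sum_i rel_entropy p (y i) <= \sum_i rel_entropy p (x i)
      + n * (3 - ln p) * Num.sqrt (8 * D / t)].
Proof.
move=> p01 x01 t0 tT D0; have /andP[p0 p1] := p01.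
have K0 : 0 <= 3 - ln p by have := ln_le0 (ltW p1); lra.
have gap := entropy_gap_sum p x p01 x01.
set T := ap_form x x x in tT gap *.
pose tau := n ^+ 2 - T.
have n0 : 0 < n by rewrite ltr0n.
(* For small [tau] the jump to the constant 1 is affordable; this case fixes the 8. *)
have [h|h] := leP tau (8 * D / t * n ^+ 2).
  exists (fun=> 1); split; first by move=> _; rewrite ler01 lexx.
    by right.
  rewrite -lerBlDl; apply: le_trans gap _; rewrite -/tau [n * _]mulrC -[leRHS]mulrA.
    rewrite ler_wpM2l//; apply: le_trans (ler_wsqrtr h) _.
  by rewrite [_ / t * _]mulrC sqrtrM ?exprn_ge0// sqrtr_sqr ger0_norm.
have tau0 : 0 < tau.
  by apply: le_lt_trans h; rewrite mulr_ge0 ?exprn_ge0// divr_ge0 ?mulr_ge0// ltW.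
(* Here [a] is [l ^+ 2]. Case [h] gives [a <= 1 / 4], hence [l <= 1 / 2], and the gain is then at
   least [3 / 4 * (a * t * tau)], which exceeds the required [a * t * tau / 2]. *)
pose a := 2 * D * n ^+ 2 / (t * tau); pose l := Num.sqrt a.
have a0 : 0 <= a by rewrite divr_ge0 ?mulr_ge0 ?exprn_ge0// ltW.
have a1 : a <= 2^-1 ^+ 2.
  rewrite /a ler_pdivrMr ?mulr_gt0//.
  have : 8 * D / t * n ^+ 2 * t <= tau * t by rewrite ler_wpM2r// ltW.
  have -> : 8 * D / t * n ^+ 2 * t = 8 * D * n ^+ 2 by field; rewrite gt_eqF.
  by rewrite !expr2; lra.
have l0 : 0 <= l by apply: sqrtr_ge0.
have l1 : l <= 2^-1.
  by rewrite -[leRHS](@ger0_norm R)// -sqrtr_sqr; apply: ler_wsqrtr.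
have l2 : l ^+ 2 = a by rewrite sqr_sqrtr.
have l01 : 0 <= l <= 1 by rewrite l0; lra.
exists (fun i => (1 - l) * x i + l); split.
- move=> i; have /andP[xi0 xi1] := x01 i; apply/andP; split; first by nra.
  by nra.
- left; apply: le_trans (ap_form_mix1 _ _ _ x01 l01 (fun=> erefl)); rewrite lerD2l l2.
  have := ap_form_defect x t x01 (ltW t0) tT; rewrite -/T -/tau.
  set X := _ - T => hX.
  have -> : D * n ^+ 2 = a * (t * tau) / 2 by rewrite /a; field; rewrite !gt_eqF.
  have -> : 3 * (1 - l) * a * X = 3 * (a * X * (1 - l)) by ring.
  have X0 : 0 <= X by have := mulr_ge0 (ltW t0) (ltW tau0); lra.
  have : a * (t * tau) <= a * (2 * X) by rewrite ler_wpM2l.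
  have : 0 <= a * X by rewrite mulr_ge0.
  have : a * X * 2^-1 <= a * X * (1 - l) by apply: ler_wpM2l; [exact: mulr_ge0|lra].
  by lra.
- have h1 : \sum_i rel_entropy p ((1 - l) * x i + l) <=
      \sum_i ((1 - l) * rel_entropy p (x i) + l * rel_entropy p 1).
    by apply: ler_sum => i _; apply: rel_entropy_convex1.
  apply: le_trans h1 _; rewrite big_split/= -!big_distrr/=.
  have : l * (\sum_(i : G) rel_entropy p 1 - \sum_i rel_entropy p (x i)) <=
    n * (3 - ln p) * Num.sqrt (8 * D / t); last first.
    by move: (\sum_(i : G) rel_entropy p 1) (\sum_i rel_entropy p (x i)) => u v; lra.
  apply: le_trans (ler_wpM2l l0 gap) _; rewrite -/tau mulrCA [n * _]mulrC -[leRHS]mulrA.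
  rewrite ler_wpM2l// /l -sqrtrM//.
  have -> : n * Num.sqrt (8 * D / t) = Num.sqrt (n ^+ 2 * (8 * D / t)).
    by rewrite [RHS]sqrtrM ?exprn_ge0// sqrtr_sqr ger0_norm.
  apply: ler_wsqrtr; have -> : a * tau = n ^+ 2 * (2 * D / t).
    by rewrite /a; field; rewrite !gt_eqF.
  apply: ler_wpM2l; first by rewrite exprn_ge0.
  apply: ler_wpM2r; first by rewrite invr_ge0 ltW.
  by apply: ler_wpM2r => //; rewrite ler_nat.
Qed.

End Boost.

(** * Second moment of the number of progressions *)

Section Concentration.
Context {R : realType} {m : nat}.
Local Notation G := 'I_m.+1.
Local Notation n := (m.+1%:R : R).
Implicit Types (x : G -> R) (A B : {set G}) (ij : G * G).

Definition progression ij : {set G} :=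
  [set ij.1; ij.1 + ij.2; ij.1 + ij.2 *+ 2].

Lemma num_3ap_sum A : (num_3ap A)%:R = \sum_ij (progression ij \subset A)%:R :> R.
Proof.
rewrite /num_3ap -sum1_card natr_sum big_mkcond/=.
by apply: eq_bigr => ij _; rewrite inE /progression; case: (_ \subset _).
Qed.

Lemma num_3ap_indicator A :
  (num_3ap A)%:R = ap_form (indicator A) (indicator A) (indicator A) :> R.
Proof.
rewrite num_3ap_sum /ap_form pair_bigA/=; apply: eq_bigr => ij _.
rewrite /progression !finset.subUset !finset.sub1set /indicator.
by case: (_ \in A); case: (_ \in A); case: (_ \in A); rewrite /= ?mul1r ?mul0r ?mulr0.
Qed.

Lemma prod_setU_disjoint x A B : [disjoint A & B] ->
  \prod_(i in A :|: B) x i = (\prod_(i in A) x i) * \prod_(i in B) x i.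
Proof. by move=> AB; rewrite -bigU//; apply: eq_bigl => i; rewrite !inE. Qed.

Lemma prod_setU_ge x A B : (forall i, 0 <= x i <= 1) ->
  (\prod_(i in A) x i) * (\prod_(i in B) x i) <= \prod_(i in A :|: B) x i.
Proof.
move=> x01; have x0 i : 0 <= x i by case/andP: (x01 i).
have -> : A :|: B = A :|: (B :\: A).
  by apply/setP => i; rewrite !inE; case: (i \in A).
rewrite [leRHS]prod_setU_disjoint; last first.
  by rewrite -finset.setI_eq0; apply/eqP/setP => i; rewrite !inE; case: (i \in A).
rewrite ler_wpM2l ?prodr_ge0// (big_setID A)/= ler_piMl ?prodr_ge0//.
by apply: prodr_ile1.
Qed.

(** In a degenerate progression the repeated points count once on the right, and dropping factors at
    most 1 only raises the product. *)
Lemma prod_progression_ge x ij : (forall i, 0 <= x i <= 1) ->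
  x ij.1 * x (ij.1 + ij.2) * x (ij.1 + ij.2 *+ 2) <= \prod_(i in progression ij) x i.
Proof.
move=> x01; have x0 i : 0 <= x i by case/andP: (x01 i).
rewrite -{1}(big_set1 *%R%R ij.1 x) -{1}(big_set1 *%R%R (ij.1 + ij.2) x).
rewrite -{1}(big_set1 *%R%R (ij.1 + ij.2 *+ 2) x).
apply: le_trans (prod_setU_ge _ _ _ x01); rewrite ler_wpM2r ?prodr_ge0//.
exact: prod_setU_ge.
Qed.

Lemma expect_num_3ap x :
  \sum_A bernoulli_weight x A * (num_3ap A)%:R =
  \sum_ij \prod_(i in progression ij) x i.
Proof.
under eq_bigr do rewrite num_3ap_sum big_distrr/=.
by rewrite exchange_big/=; apply: eq_bigr => ij _; rewrite expect_subset.
Qed.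

Lemma expect_num_3ap_ge x : (forall i, 0 <= x i <= 1) ->
  ap_form x x x <= \sum_A bernoulli_weight x A * (num_3ap A)%:R.
Proof.
move=> x01; rewrite expect_num_3ap /ap_form pair_bigA/=.
by apply: ler_sum => ij _; apply: prod_progression_ge.
Qed.

(** For each of the nine pairs of slots that may meet, [kl.1] is determined by [ij] and [kl.2]. *)
Lemma sum_meeting_progressions :
  \sum_(ij : G * G) \sum_(kl : G * G)
    (~~ [disjoint progression ij & progression kl])%:R <= 9 * n ^+ 3.
Proof.
have key ij kl : (~~ [disjoint progression ij & progression kl])%:R <=
    \sum_(a < 3) \sum_(b < 3) (ij.1 + ij.2 *+ a == kl.1 + kl.2 *+ b)%:R :> R.
  have [|/pred0Pn[v/= /andP[]]] := boolP [disjoint _ & _].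
    by move=> _; apply: sumr_ge0 => a _; apply: sumr_ge0.
  have mem (uv : G * G) : v \in progression uv ->
      exists a : 'I_3, v = uv.1 + uv.2 *+ a.
    rewrite !inE -orbA => /or3P[] /eqP->.
    - by exists ord0; rewrite mulr0n addr0.
    - by exists (inord 1); rewrite inordK.
    - by exists (inord 2); rewrite inordK.
  move=> /mem[a va] /mem[b vb].
  rewrite (bigD1 a)//= (bigD1 b)//= -va -vb eqxx -addrA lerDl addr_ge0//.
    by rewrite sumr_ge0.
  by rewrite sumr_ge0// => c _; rewrite sumr_ge0.
apply: le_trans (ler_sum _ (fun ij _ => ler_sum _ (fun kl _ => key ij kl))) _.
under eq_bigr => ij _.
  rewrite exchange_big/=; under eq_bigr do rewrite exchange_big/=.
  over.
rewrite exchange_big/=; under eq_bigr do rewrite exchange_big/=.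
have e (a b : 'I_3) : \sum_(ij : G * G) \sum_(kl : G * G)
    (ij.1 + ij.2 *+ a == kl.1 + kl.2 *+ b)%:R = n ^+ 3.
  rewrite -(pair_bigA _ (fun i j => \sum_(kl : G * G) (i + j *+ a == kl.1 + kl.2 *+ b)%:R))/=.
  under eq_bigr => i _.
    under eq_bigr => j _.
      rewrite -(pair_bigA _ (fun k l => (i + j *+ a == k + l *+ b)%:R))/= exchange_big/=.
      under eq_bigr => l _.
        rewrite (bigD1 (i + j *+ a - l *+ b))//= addrNK eqxx big1 ?addr0; last first.
          by move=> k; rewrite eq_sym subr_eq => /negbTE->.
        over.
      rewrite sumr_const card_ord.
      over.
    rewrite sumr_const card_ord.
    over.
  by rewrite sumr_const card_ord -!mulrnA -natrX mul1n !expnS expn0 muln1.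
rewrite (eq_bigr (fun=> 3 * n ^+ 3)) => [|a _].
  by rewrite sumr_const card_ord le_eqVlt; apply/orP; left; apply/eqP; ring.
by rewrite (eq_bigr (fun=> n ^+ 3)) => [|b _]; rewrite ?e// sumr_const card_ord; ring.
Qed.

(** Disjoint progressions are independent; each meeting pair adds at most 1. *)
Lemma num_3ap_second_moment x : (forall i, 0 <= x i <= 1) ->
  \sum_A bernoulli_weight x A * (num_3ap A)%:R ^+ 2 <=
  (\sum_A bernoulli_weight x A * (num_3ap A)%:R) ^+ 2 + 9 * n ^+ 3.
Proof.
move=> x01; have x0 i : 0 <= x i by case/andP: (x01 i).
rewrite expect_num_3ap; apply: le_trans (lerD (lexx _) sum_meeting_progressions).
under eq_bigr do rewrite num_3ap_sum expr2 big_distrlr/= big_distrr/=.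
rewrite exchange_big/= expr2 big_distrlr/= -big_split/=; apply: ler_sum => ij _.
under eq_bigr do rewrite big_distrr/=.
rewrite exchange_big/= -big_split/=; apply: ler_sum => kl _.
have -> : \sum_A bernoulli_weight x A *
    ((progression ij \subset A)%:R * (progression kl \subset A)%:R) =
    \prod_(i in progression ij :|: progression kl) x i.
  rewrite -expect_subset; apply: eq_bigr => A _.
  by rewrite finset.subUset -natrM mulnb.
have [dis|_] /= := boolP [disjoint _ & _].
  by rewrite addr0 prod_setU_disjoint.
rewrite ler_wpDl// ?mulr_ge0 ?prodr_ge0//.
by apply: prodr_ile1.
Qed.

(** The mean is at least [ap_form x x x], so falling [s] below the form means falling at least [s]
    below the mean. *)
Lemma num_3ap_chebyshev x (s : R) : (forall i, 0 <= x i <= 1) -> 0 < s ->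
  \sum_(A | (num_3ap A)%:R < ap_form x x x - s) bernoulli_weight x A <=
  9 * n ^+ 3 / s ^+ 2.
Proof.
move=> x01 s0; have w0 A := bernoulli_weight_ge0 x A x01.
pose mu := \sum_A bernoulli_weight x A * (num_3ap A)%:R.
have hmu : ap_form x x x <= mu by apply: expect_num_3ap_ge.
have var : \sum_A bernoulli_weight x A * ((num_3ap A)%:R - mu) ^+ 2 <= 9 * n ^+ 3.
  have -> : \sum_A bernoulli_weight x A * ((num_3ap A)%:R - mu) ^+ 2 =
      \sum_A bernoulli_weight x A * (num_3ap A)%:R ^+ 2 - mu ^+ 2.
    transitivity (\sum_A bernoulli_weight x A * (num_3ap A)%:R ^+ 2
        - (\sum_A bernoulli_weight x A * (num_3ap A)%:R) * (2 * mu)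
        + (\sum_A bernoulli_weight x A) * mu ^+ 2).
      rewrite !big_distrl/= -sumrB -big_split/=; apply: eq_bigr => A _; ring.
    by rewrite sum_bernoulli_weight -/mu; ring.
  by rewrite lerBlDl num_3ap_second_moment.
rewrite ler_pdivlMr ?exprn_gt0//; apply: le_trans var.
rewrite big_distrl/= big_mkcond/=; apply: ler_sum => A _.
case: ifP => [h|_]; last by rewrite mulr_ge0 ?sqr_ge0.
rewrite ler_wpM2l// -[leRHS]sqrrN opprB lerXn2r ?nnegrE ?ltW//; first by lra.
by lra.
Qed.

Lemma mean_3apE (p : R) : mean_3ap (m := m) p =
  \sum_A bernoulli_weight (fun _ : G => p) A * (num_3ap A)%:R.
Proof. by []. Qed.

Lemma mean_3ap_ge (p : R) : 0 <= p <= 1 -> n ^+ 2 * p ^+ 3 <= mean_3ap (m := m) p.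
Proof.
move=> p01; rewrite mean_3apE; apply: le_trans (expect_num_3ap_ge _ (fun=> p01)).
rewrite /ap_form; under eq_bigr do rewrite sumr_const card_ord.
by rewrite sumr_const card_ord -mulrnA -[leRHS]mulr_natr natrM le_eqVlt; apply/orP; left; apply/eqP; ring.
Qed.

End Concentration.

(** * The tail probability against the entropy infimum *)

Section TailBounds.
Context {R : realType} {m : nat}.
Local Notation G := 'I_m.+1.
Local Notation n := (m.+1%:R : R).
Context (p u : R) (p01 : 0 < p < 1) (u1 : 1 < u).
Context (P0 : 0 < prob_upper_tail (m := m) p u).
Implicit Types (x : G -> R) (A S : {set G}).

Local Notation P := (prob_upper_tail (m := m) p u).
Local Notation goal := (u * mean_3ap (m := m) p).
Local Notation feasible := (feasible (m := m) p u).

Let n0 : 0 < n. Proof. by rewrite ltr0n. Qed.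

Let p3_0 : 0 < p ^+ 3. Proof. by rewrite exprn_gt0//; case/andP: p01. Qed.

Let lnp_le0 : ln p <= 0.
Proof. by apply: ln_le0; case/andP: p01 => _ /ltW. Qed.

Let weight_ge0 A : 0 <= bernoulli_weight (fun=> p) A.
Proof. by apply: bernoulli_weight_ge0 => _; case/andP: p01 => /ltW-> /ltW->. Qed.

Let one01 (i : G) : 0 <= (1 : R) <= 1. Proof. by rewrite ler01 lexx. Qed.

Let PE : P = \sum_(A : {set G} | goal <= (num_3ap A)%:R) bernoulli_weight (fun=> p) A.
Proof. by []. Qed.

Let goal_ge : u * (n ^+ 2 * p ^+ 3) <= goal.
Proof.
rewrite ler_wpM2l//; first by rewrite (le_trans _ (ltW u1)).
by apply: mean_3ap_ge; case/andP: p01 => /ltW-> /ltW->.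
Qed.

Let goal_ge_p3 : p ^+ 3 * n ^+ 2 <= goal.
Proof.
apply: le_trans goal_ge; rewrite mulrC ler_peMl ?(ltW u1)//.
by rewrite mulr_ge0 ?(ltW p3_0)// exprn_ge0.
Qed.

Lemma ap_form_one : ap_form (fun _ : G => 1) (fun=> 1) (fun=> 1) = n ^+ 2 :> R.
Proof.
rewrite /ap_form; under eq_bigr do rewrite sumr_const card_ord.
by rewrite sumr_const card_ord -mulrnA !mulr1 -natrX.
Qed.

(** A tail of positive probability contains a set, whose count is at most [n ^+ 2]; this makes the
    constant 1 feasible and the infimum finite. *)
Let goal_le : goal <= n ^+ 2.
Proof.
have [A hA|noA] := pickP (fun A : {set G} => goal <= (num_3ap A)%:R).
  apply: le_trans hA _; rewrite num_3ap_indicator; apply: ap_form_le_card.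
  exact: indicator01.
by move: P0; rewrite PE big_pred0 ?ltxx.
Qed.

Lemma feasible_one : feasible (fun=> 1).
Proof. by split; [exact: one01|rewrite [leRHS]ap_form_one]. Qed.

(** Markov's inequality. It keeps [- ln P] away from 0 uniformly in [n] and [p]. *)
Lemma ln_tail_ge : ln u <= - ln P.
Proof.
have u0 : 0 < u by apply: lt_trans u1.
have mu0 : 0 < mean_3ap (R := R) (m := m) p.
  rewrite -(pmulr_rgt0 _ u0); apply: lt_le_trans goal_ge_p3.
  by rewrite mulr_gt0// exprn_gt0.
rewrite lerNr -lnV ?posrE// ler_ln ?posrE ?invr_gt0//.
rewrite -(ler_pM2l (mulr_gt0 u0 mu0)) [leRHS]mulrAC divff ?gt_eqF// mul1r.
rewrite PE big_distrr/= [leRHS]mean_3apE.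
rewrite [leRHS](bigID (fun A : {set G} => goal <= (num_3ap A)%:R))/= ler_wpDr//.
  by apply: sumr_ge0 => A _; rewrite mulr_ge0.
by apply: ler_sum => A hA; rewrite mulrC ler_wpM2l.
Qed.

(** From the constant [p] to [x] the form rises by at least [(u - 1) * n ^+ 2 * p ^+ 3], so the
    Lipschitz bound forces a large l1 distance. Cauchy-Schwarz and the quadratic entropy bound
    conclude, with [36 = 9 * 4]. *)
Lemma entropy_sum_ge x : feasible x ->
  (u - 1) ^+ 2 / 36 * n * p ^+ 6 <= rel_entropy_sum p x.
Proof.
move=> [x01 hx]; have pc (i : G) : 0 <= p <= 1 by case/andP: p01 => /ltW-> /ltW->.
have h := ap_form_lipschitz x (fun=> p) x01 pc.
have ep : ap_form (fun _ : G => p) (fun=> p) (fun=> p) = n ^+ 2 * p ^+ 3.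
  rewrite /ap_form; under eq_bigr do rewrite sumr_const card_ord.
  by rewrite sumr_const card_ord -mulrnA -[LHS]mulr_natr natrM; ring.
set s := \sum_i _ in h.
have hs : (u - 1) * n * p ^+ 3 / 3 <= s.
  rewrite -(ler_pM2l n0) -(ler_pM2l (_ : 0 < 3))//.
  have -> : 3 * (n * ((u - 1) * n * p ^+ 3 / 3)) = u * (n ^+ 2 * p ^+ 3) - n ^+ 2 * p ^+ 3.
    by field.
  rewrite [leRHS]mulrA; apply: le_trans h; rewrite ep lerD2r.
  exact: le_trans goal_ge hx.
have hI : \sum_i `|x i - p| ^+ 2 / 4 <= rel_entropy_sum p x.
  apply: ler_sum => i _; rewrite real_normK ?num_real//.
  by apply: rel_entropy_ge_sqr.
apply: le_trans hI; rewrite -big_distrl/= ler_pdivlMr// -(ler_pM2l n0).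
apply: le_trans (_ : s ^+ 2 <= _); last first.
  by have := sqr_sum_le _ (fun i => `|x i - p|); rewrite card_ord.
have -> : n * ((u - 1) ^+ 2 / 36 * n * p ^+ 6 * 4) = ((u - 1) * n * p ^+ 3 / 3) ^+ 2.
  by field.
have h0 : 0 <= (u - 1) * n * p ^+ 3 / 3.
  apply: divr_ge0 => //; apply: mulr_ge0; last exact: ltW.
  by apply: mulr_ge0 => //; rewrite subr_ge0 ltW.
by rewrite lerXn2r ?nnegrE// (le_trans h0).
Qed.

(** The error 1 covers the factor 2 of the random cover, [n * q] covers [(1 + q) ^+ m.+1], and the
    last term is the price of regaining the loss [12 * r * n ^+ 2] on a class, at level
    [p ^+ 3 / 2]: [192 = 8 * 12 * 2]. *)
Lemma entropy_inf_le_tail (q r t : R) :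
  0 < q <= 1 -> 0 <= r -> 1 <= r ^+ 4 * n * q ^+ 4 ->
  (forall x, feasible x -> t <= rel_entropy_sum p x) ->
  t <= - ln P + (1 + n * q + n * (3 - ln p) * Num.sqrt (192 * r / p ^+ 3)).
Proof.
move=> q01 r0 rq ht; set err := n * (3 - ln p) * _.
have /andP[q0 q1] := q01.
pose d := 2 * n ^+ 2 * r.
pose C S A := `[< ap_close (fun i => indicator S i / q) d (indicator A) >].
have hC S : \sum_(A : {set G} | (goal <= (num_3ap A)%:R) && C S A)
    bernoulli_weight (fun=> p) A <= expR (- (t - err)).
  have [Z0|Z0] := ltP 0 (\sum_(A : {set G} | (goal <= (num_3ap A)%:R) && C S A)
    bernoulli_weight (fun=> p) A); last exact: le_trans Z0 (expR_ge0 _).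
  have [x [x01 hx Zx]] : exists x, [/\ forall i, 0 <= x i <= 1,
      goal - 6 * d <= ap_form x x x &
      \sum_(A : {set G} | (goal <= (num_3ap A)%:R) && C S A) bernoulli_weight (fun=> p) A
        <= expR (- \sum_i rel_entropy p (x i))].
    apply: (close_class_bound p _ (fun i => indicator S i / q) d goal p01 Z0) => A.
      by move=> /andP[_ /asboolP].
    by move=> /andP[h _]; rewrite -num_3ap_indicator.
  apply: le_trans Zx _; rewrite ler_expR lerN2 lerBlDr.
  pose D := 12 * r.
  have D0 : 0 <= D by rewrite mulr_ge0.
  have dD : 6 * d = D * n ^+ 2 by rewrite /d /D; ring.
  have [hD|hD] := leP D (p ^+ 3 / 2).
    have hx' : p ^+ 3 / 2 * n ^+ 2 <= ap_form x x x.
      apply: le_trans hx; rewrite dD lerBrDr.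
      apply: le_trans goal_ge_p3; rewrite -mulrDl ler_wpM2r ?exprn_ge0//; lra.
    have [|y [y01 hy Iy]] := boost p x (p ^+ 3 / 2) D p01 x01 _ hx' D0.
      by rewrite divr_gt0.
    apply: le_trans (ht y _) _; last first.
      apply: le_trans Iy _; rewrite lerD2l /err.
      have -> : 8 * D / (p ^+ 3 / 2) = 192 * r / p ^+ 3.
        by rewrite /D; field; rewrite gt_eqF//; case/andP: p01.
      by [].
    case: hy => [hy|->]; last exact: feasible_one.
    split => //; apply: le_trans hy; move: hx; rewrite dD; lra.
  (* Now [192 * r / p ^+ 3 > 8], so [err] covers the whole gap between [x] and the constant 1. *)
  apply: le_trans (ht _ feasible_one) _; rewrite -lerBlDl.
  apply: le_trans (entropy_gap_sum p x p01 x01) _.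
  rewrite /err [n * _]mulrC -[leRHS]mulrA ler_wpM2l//; first by have := lnp_le0; lra.
  apply: (@le_trans _ _ (n * 1)).
    rewrite mulr1 -[leRHS](ger0_norm (ltW n0)) -sqrtr_sqr; apply: ler_wsqrtr.
    rewrite gerBl; apply: sumr_ge0 => i _; apply: sumr_ge0 => j _.
    by rewrite !mulr_ge0//; apply: (andP (x01 _)).1.
  rewrite ler_wpM2l// -[leLHS]sqrtr1; apply: ler_wsqrtr.
  by rewrite ler_pdivlMr// mul1r; move: hD; rewrite /D; lra.
have hA A : 2^-1 <= \sum_(S | C (A :&: S) A) bernoulli_weight (fun=> q) S.
  exact: ap_close_sampling.
have := random_cover_bound _ _ q _ C (fun A : {set G} => goal <= (num_3ap A)%:R)
  weight_ge0 _ hA hC.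
rewrite (ltW q0) q1 -PE card_ord => /(_ isT) hP.
have hq : (1 + q) ^+ m.+1 <= expR (n * q).
  rewrite expRM_natl lerXn2r ?nnegrE ?expR_ge0 ?expR_ge1Dx//.
  by rewrite addr_ge0// ltW.
have h2 : (2 : R) <= expR 1 by have := expR_ge1Dx (1 : R); lra.
have : P <= expR (1 + n * q - (t - err)).
  apply: le_trans hP _; rewrite !expRD ler_wpM2r ?expR_ge0//.
  by apply: ler_pM => //; rewrite exprn_ge0// addr_ge0// ltW.
by rewrite -{1}(lnK P0) ler_expR; lra.
Qed.

(** The boosted point has margin [D * n ^+ 2] over the goal, so its product measure misses the event
    with probability at most [9 / (D ^+ 2 * n)]. If the boost ends at the constant 1, the full set
    carries all the mass. *)
Lemma tail_le_entropy (D : R) x : 0 < D -> feasible x ->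
  - ln P * (1 - 9 / (D ^+ 2 * n)) <=
  rel_entropy_sum p x + n * (3 - ln p) * Num.sqrt (8 * D / p ^+ 3) + 1.
Proof.
move=> D0 [x01 hx].
have [|y [y01 hy Iy]] := boost p x (p ^+ 3) D p01 x01 p3_0 _ (ltW D0).
  exact: le_trans goal_ge_p3 hx.
have t0 : 0 <= - ln P by apply: le_trans ln_tail_ge; rewrite ln_ge0// ltW.
have := prob_lower_bound p y (fun A : {set G} => goal <= (num_3ap A)%:R) p01 y01 P0.
rewrite -PE => hl; apply: le_trans (lerD Iy (lexx 1)); apply: le_trans hl.
rewrite mulrC ler_wpM2r//; case: hy => [hy|y1].
  have := num_3ap_chebyshev y (D * n ^+ 2) y01 (mulr_gt0 D0 (exprn_gt0 2 n0)).
  have -> : 9 * n ^+ 3 / (D * n ^+ 2) ^+ 2 = 9 / (D ^+ 2 * n).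
    by field; rewrite !gt_eqF.
  have := sum_bernoulli_weight y.
  rewrite (bigID (fun A : {set G} => goal <= (num_3ap A)%:R))/= => s1 hc.
  rewrite lerBlDr -{1}s1 lerD2l; apply: le_trans hc.
  rewrite big_mkcond [leRHS]big_mkcond/=; apply: ler_sum => A _.
  have w0 := bernoulli_weight_ge0 y A y01.
  case: ifPn => [|_]; last by case: ifP.
  rewrite -ltNge => h; case: ifPn => //; rewrite -leNgt => h'.
  have : ap_form x x x <= (num_3ap A)%:R by lra.
  by have := le_trans hx (_ : ap_form x x x <= _) => /[apply]; rewrite leNgt h.
apply: (@le_trans _ _ 1); first by rewrite gerBl divr_ge0// mulr_ge0 ?exprn_ge0 ?ltW.
have hT : goal <= (num_3ap [set: G])%:R.
  rewrite num_3ap_indicator; apply: le_trans goal_le _; rewrite -ap_form_one.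
  by rewrite le_eqVlt; apply/orP; left; apply/eqP/ap_form_ext => i; rewrite /indicator inE.
rewrite (bigD1 [set: G])//= -[leLHS]addr0 lerD//.
  by rewrite /bernoulli_weight y1 big1// => i _; rewrite inE.
by apply: sumr_ge0 => A _; apply: bernoulli_weight_ge0.
Qed.

End TailBounds.

(** * Conversion of the additive errors into relative ones *)

Section Exponents.
Context {R : realType}.
Implicit Types (L l k : R).

Lemma powR_expR (a x : R) : 0 < a -> a `^ x = expR (x * ln a).
Proof. by move=> a0; rewrite /powR gt_eqF. Qed.

Lemma sqrt_expR (x : R) : Num.sqrt (expR x) = expR (x / 2).
Proof.
have -> : expR x = expR (x / 2) ^+ 2 by rewrite -expRM_natl; congr expR; field.
by rewrite sqrtr_sqr ger0_norm ?expR_ge0.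
Qed.

Lemma sqrt_mul_expR (a b x : R) : 0 <= a -> a <= b ^+ 2 -> 0 <= b ->
  Num.sqrt (a * expR x) <= b * expR (x / 2).
Proof.
move=> a0 ab b0; rewrite sqrtrM// sqrt_expR ler_wpM2r ?expR_ge0//.
by rewrite -[leRHS](ger0_norm b0) -sqrtr_sqr ler_wsqrtr.
Qed.

(* Here n = exp L and p = exp (- l). *)
Lemma upper_numeric k lu : 0 < k -> 0 < lu -> exists C,
  forall L l th t, 1 / 2 <= L -> 0 <= l -> 162 * l <= L -> lu <= t ->
  k * expR L * expR (- (6 * l)) <= th -> th <= expR L * l ->
  th <= t + (1 + expR L * expR (- L / 12)
          + expR L * (3 + l) * Num.sqrt (192 * expR (- L / 6 + 3 * l))) ->
  th <= t * (1 + C * (expR (- L / 29 + 162 / 29 * l) * L `^ (33 / 29))).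
Proof.
move=> k0 lu0; pose N := expR (50 * ln (204 * 60 / k)).
(* [N] bounds [expR L] in the case where the error is not small against [th]; there a constant
   depending on [k] and [lu] suffices. *)
have N0 : 0 <= N by apply: expR_ge0.
have C1 : 0 <= 408 / k by rewrite divr_ge0// ltW.
have C2 : 0 <= 4 * N ^+ 3 / lu.
  by rewrite divr_ge0 ?mulr_ge0 ?exprn_ge0// ltW.
exists (408 / k + 4 * N ^+ 3 / lu) => L l th t hL hl lL ht th1 th2 th3.
have L0 : 0 < L by lra.
have t0 : 0 < t by apply: lt_le_trans ht.
set w := expR (- L / 12 + 3 / 2 * l) * L.
have w0 : 0 <= w by rewrite mulr_ge0 ?expR_ge0// ltW.
have eL0 := expR_gt0 L.
set err := (X in _ <= t + X) in th3.
(* [102 = 2 + 2 + 98], and [98 = 14 * 7] from [192 <= 14 ^+ 2] and [3 + l <= 7 * L]. *)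
have herr : err <= 102 * (expR L * w).
  have e1 : 1 <= 2 * (expR L * w).
    rewrite /w !mulrA -[2 * _ * _]mulrA -expRD.
    have : 1 <= expR (L + (- L / 12 + 3 / 2 * l)) by rewrite -[leLHS]expR0 ler_expR; lra.
    by move: (expR _) => z z1; nra.
  have e2 : expR L * expR (- L / 12) <= 2 * (expR L * w).
    rewrite mulrCA ler_wpM2l ?(ltW eL0)//.
    have : expR (- L / 12) <= expR (- L / 12 + 3 / 2 * l) by rewrite ler_expR; lra.
    rewrite /w; have := expR_ge0 (- L / 12).
    by move: (expR (- L / 12)) (expR _) => z z' z0 zz'; nra.
  have e3 : expR L * (3 + l) * Num.sqrt (192 * expR (- L / 6 + 3 * l)) <=
      98 * (expR L * w).
    rewrite -[leLHS]mulrA [leRHS]mulrCA ler_wpM2l ?(ltW eL0)//.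
    have hs : Num.sqrt (192 * expR (- L / 6 + 3 * l)) <= 14 * expR (- L / 12 + 3 / 2 * l).
      have -> : - L / 12 + 3 / 2 * l = (- L / 6 + 3 * l) / 2 by field.
      by apply: sqrt_mul_expR => //; rewrite -natrX ler_nat.
    apply: le_trans (ler_pM _ _ (_ : 3 + l <= 7 * L) hs) _; rewrite ?sqrtr_ge0//; [lra|lra|].
    by rewrite /w le_eqVlt; apply/orP; left; apply/eqP; ring.
  by rewrite /err; lra.
set eta := expR (- L / 29 + 162 / 29 * l) * L `^ (33 / 29).
(* For [L < 1] the power [33 / 29] shrinks [L], but it stays above [L ^+ 2], and [1 / 2 <= L]. *)
have hpow : L / 2 <= L `^ (33 / 29).
  have [L1|L1] := leP 1 L.
    apply: (@le_trans _ _ L); first by lra.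
    by apply: le1r_powR => //; lra.
  apply: (@le_trans _ _ (L `^ 2%:R)).
    by rewrite powR_mulrn ?(ltW L0)// expr2; nra.
  by apply: ger_powR; [rewrite L0 ltW|lra].
have eta0 : 0 <= eta by rewrite mulr_ge0 ?expR_ge0 ?powR_ge0.
have hw : w <= 2 * eta * expR (- (6 * l)).
  apply: (@le_trans _ _ (expR (- L / 29 + 162 / 29 * l) * L * expR (- (6 * l)))).
    rewrite mulrAC -expRD /w ler_wpM2r ?(ltW L0)// ler_expR; lra.
  rewrite ler_wpM2r ?expR_ge0// /eta mulrCA ler_wpM2l ?expR_ge0//; lra.
have eC : t * (1 + (408 / k + 4 * N ^+ 3 / lu) * eta) =
  t + t * (408 / k * eta) + t * (4 * N ^+ 3 / lu * eta) by ring.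
(* In the first case the error is at most [th / 2], so [th <= 2 * t] and [t] itself is of order at
   least [expR L * expR (- (6 * l))]. *)
have [h|h] := leP (204 * w) (k * expR (- (6 * l))).
  have tth : k * expR L * expR (- (6 * l)) <= 2 * t.
    have : expR L * (204 * w) <= expR L * (k * expR (- (6 * l))) by rewrite ler_wpM2l// ltW.
    have -> : expR L * (k * expR (- (6 * l))) = k * expR L * expR (- (6 * l)) by ring.
    have -> : expR L * (204 * w) = 204 * (expR L * w) by ring.
    move: th1 th3 herr; lra.
  have h1 : expR L * w <= 2 * eta * (2 * t / k).
    apply: (@le_trans _ _ (2 * eta * (expR L * expR (- (6 * l))))).
      by rewrite [leRHS]mulrCA ler_wpM2l ?(ltW eL0).
    apply: ler_wpM2l; first exact: mulr_ge0.
    by rewrite ler_pdivlMr// [leLHS]mulrC mulrA.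
  have : 102 * (2 * eta * (2 * t / k)) = t * (408 / k * eta) by field; rewrite gt_eqF.
  have : 0 <= t * (4 * N ^+ 3 / lu * eta) by rewrite mulr_ge0 ?(ltW t0)// mulr_ge0.
  rewrite eC; move: th3 herr h1.
  move: (t * (408 / k * eta)) (t * (4 * N ^+ 3 / lu * eta)) => a b.
  by move: (expR L * w) (2 * eta * (2 * t / k)) => c d; lra.
(* A large [w] forces [L] to be bounded. The exponents fit because [1 / 60 + 1 / 50 + (15 / 2) / 162
   <= 1 / 12], which nearly exhausts [162 * l <= L]. *)
have hk : k * expR (L / 50) <= 204 * 60.
  have hL60 : L <= 60 * expR (L / 60) by have := expR_ge1Dx (L / 60); lra.
  have : k * expR (- (6 * l)) <= 204 * 60 * (expR (- L / 12 + 3 / 2 * l) * expR (L / 60)).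
    apply: le_trans (ltW h) _; rewrite /w.
    have := ler_wpM2l (expR_ge0 (- L / 12 + 3 / 2 * l)) hL60; lra.
  rewrite -(ler_pM2r (expR_gt0 (6 * l + L / 50))) -!mulrA -!expRD.
  have -> : - (6 * l) + (6 * l + L / 50) = L / 50 by ring.
  move/le_trans; apply; rewrite mulrA ler_piMr// -[leRHS]expR0 ler_expR; lra.
have hn : expR L <= N.
  rewrite ler_expR -ler_pdivrMl// mulrC -(expRK (L / 50)).
  rewrite ler_ln ?posrE ?expR_gt0 ?divr_gt0 ?mulr_gt0//.
  by rewrite ler_pdivlMr// mulrC.
have hLn : l <= expR L by have := expR_ge1Dx L; lra.
have he : 1 <= 4 * expR L * eta.
  have : expR (- L) * (1 / 4) <= eta.
    rewrite /eta ler_pM ?expR_ge0 ?ler_expR//; lra.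
  rewrite expRN mulrC ler_pdivrMr// ; lra.
apply: (@le_trans _ _ (expR L ^+ 2)).
  by apply: le_trans th2 _; rewrite expr2 ler_wpM2l// ltW.
apply: (@le_trans _ _ (4 * expR L ^+ 3 * eta)).
  have := ler_wpM2l (exprn_ge0 2 (ltW eL0)) he; rewrite mulr1 => /le_trans; apply.
  by rewrite le_eqVlt; apply/orP; left; apply/eqP; ring.
apply: (@le_trans _ _ (4 * N ^+ 3 * eta * (t / lu))).
  rewrite -[leLHS]mulr1; apply: ler_pM => //.
  - by do 2!apply: mulr_ge0 => //; apply: exprn_ge0; apply: ltW.
  - apply: ler_wpM2r => //; apply: ler_wpM2l => //.
    by apply: lerXn2r; rewrite ?nnegrE// ltW.
  - by rewrite ler_pdivlMr// mul1r.
have -> : 4 * N ^+ 3 * eta * (t / lu) = t * (4 * N ^+ 3 / lu * eta) by ring.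
have : 0 <= t * (408 / k * eta) by rewrite mulr_ge0 ?(ltW t0)// mulr_ge0.
rewrite eC; move: (t * (408 / k * eta)) (t * (4 * N ^+ 3 / lu * eta)) => a b.
by lra.
Qed.

Lemma lower_numeric k : 0 < k -> exists c,
  forall L l th t, 1 / 2 <= L -> 0 <= l -> 162 * l <= L -> 0 < t ->
  k * expR L * expR (- (6 * l)) <= th ->
  t * (1 - 9 * expR (- L / 5)) <= th
     + expR L * (3 + l) * Num.sqrt (8 * expR (- (2 / 5) * L + 3 * l)) + 1 ->
  t * (1 - c * (expR (- L / 6 + 6 * l) * L)) <= th.
Proof.
(* 18 pays for the Chebyshev factor, 21 for the boost and 2 for the additive 1. *)
move=> k0; exists (18 + 23 / k) => L l th t hL hl lL t0 th1 th2.
have L0 : 0 < L by lra.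
set eta := expR (- L / 6 + 6 * l) * L.
have eta0 : 0 <= eta by rewrite mulr_ge0 ?expR_ge0// ltW.
have c0 : 0 <= 18 + 23 / k by rewrite addr_ge0// divr_ge0// ltW.
have eL0 := expR_gt0 L.
(* If [t <= th] the claim is immediate; otherwise [t] inherits the lower bound on [th], against
   which the errors become relative. *)
have [tth|tth] := leP t th.
  by apply: le_trans tth; rewrite ler_piMr ?(ltW t0)// gerBl mulr_ge0.
have kt : k * expR L * expR (- (6 * l)) <= t by apply: le_trans th1 (ltW tth).
have e1 : t * (9 * expR (- L / 5)) <= t * (18 * eta).
  rewrite ler_wpM2l ?(ltW t0)// /eta.
  have : expR (- L / 5) <= expR (- L / 6 + 6 * l) by rewrite ler_expR; lra.
  have := expR_ge0 (- L / 5).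
  by move: (expR (- L / 5)) (expR _) => z z' z0 zz'; nra.
have hn : expR L <= t / k * expR (6 * l).
  rewrite -(ler_pM2l k0) -(ler_pM2r (expR_gt0 (- (6 * l)))).
  have -> : k * (t / k * expR (6 * l)) * expR (- (6 * l)) =
      t * (expR (6 * l) * expR (- (6 * l))) by field; rewrite gt_eqF.
  by rewrite -expRD subrr expR0 mulr1.
have e2 : expR L * (3 + l) * Num.sqrt (8 * expR (- (2 / 5) * L + 3 * l)) <=
    t * (21 / k * eta).
  have hs : Num.sqrt (8 * expR (- (2 / 5) * L + 3 * l)) <= 3 * expR (- L / 5 + 3 / 2 * l).
    have -> : - L / 5 + 3 / 2 * l = (- (2 / 5) * L + 3 * l) / 2 by field.
    by apply: sqrt_mul_expR => //; rewrite -natrX ler_nat.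
  have h7 : 3 + l <= 7 * L by lra.
  have l3 : 0 <= 3 + l by lra.
  have hm := ler_pM (ltW eL0) l3 hn h7.
  apply: le_trans (ler_pM (mulr_ge0 (ltW eL0) l3) (sqrtr_ge0 _) hm hs) _.
  have -> : t / k * expR (6 * l) * (7 * L) * (3 * expR (- L / 5 + 3 / 2 * l)) =
     t * (21 / k * ((expR (6 * l) * expR (- L / 5 + 3 / 2 * l)) * L)) by ring.
  rewrite ler_wpM2l ?(ltW t0)// ler_wpM2l ?divr_ge0 ?(ltW k0)//.
  by rewrite /eta ler_wpM2r ?(ltW L0)// -expRD ler_expR; lra.
have e3 : 1 <= t * (2 / k * eta).
  have : expR L * expR (- L) <= t / k * expR (6 * l) * expR (- L).
    by rewrite ler_wpM2r ?expR_ge0.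
  rewrite -expRD subrr expR0 => /le_trans; apply.
  rewrite -mulrA -expRD.
  have : expR (6 * l - L) <= expR (- L / 6 + 6 * l) by rewrite ler_expR; lra.
  have := expR_ge0 (6 * l - L); rewrite /eta.
  move: (expR (6 * l - L)) (expR (- L / 6 + 6 * l)) => z z' z0 zz'.
  have -> : t * (2 / k * (z' * L)) = t / k * (2 * (z' * L)) by ring.
  by rewrite ler_wpM2l ?divr_ge0 ?(ltW t0) ?(ltW k0)//; nra.
have -> : t * (1 - (18 + 23 / k) * eta) =
  t - (t * (18 * eta) + t * (21 / k * eta) + t * (2 / k * eta)) by ring.
move: th2 e1 e2 e3; rewrite mulrBr mulr1.
by move: (t * (18 * eta)) (t * (21 / k * eta)) (t * (2 / k * eta)) (t * (9 * _)) => *; lra.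
Qed.

End Exponents.

(* The modulus is N = m.+1, with n its image in R.  The premise
   0 < prob_upper_tail says that the tail event is possible; when it is not,
   the quotient of the paper is the meaningless oo / oo. *)
Theorem theorem1p5 (R : realType) (u : R) (hu : 1 < u) :
  exists C c : R, forall (m : nat) (p : R),
    let n : R := m.+1%:R in
    n `^ (- (1 / 162)) <= p -> p <= 1 - n^-1 ->
    0 < prob_upper_tail (m := m) p u ->
    ((1 - c * n `^ (- (1 / 6)) * p ^- 6 * ln n)%:E
       <= theta (m := m) p u / (- ln (prob_upper_tail (m := m) p u))%:E
       <= (1 + C * n `^ (- (1 / 29)) * p `^ (- (162 / 29))
             * ln n `^ (33 / 29))%:E)%E.
Proof.
have u0 : 0 < u by apply: lt_trans hu.
have k0 : 0 < (u - 1) ^+ 2 / 36 by rewrite divr_gt0// exprn_gt0// subr_gt0.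
have [C hC] := upper_numeric ((u - 1) ^+ 2 / 36) (ln u) k0 (ln_gt0 hu).
have [c hc] := lower_numeric ((u - 1) ^+ 2 / 36) k0.
exists C, c => m p n np pn P0.
have n0 : 0 < n by rewrite ltr0n.
have p0 : 0 < p by apply: lt_le_trans np; apply: powR_gt0.
have p1 : p < 1 by apply: le_lt_trans pn _; rewrite ltrBlDr ltrDl invr_gt0.
have p01 : 0 < p < 1 by rewrite p0 p1.
(* The two bounds on [p] exclude [n = 1], so [ln n] is at least [1 / 2]. *)
have n2 : 2 <= n.
  rewrite /n ler_nat; case: (posnP m) => [m0|//].
  by move: pn; rewrite /n m0 invr1 subrr leNgt p0.
pose L := ln n; pose l := - ln p.
have eL : n = expR L by rewrite /L lnK.
have el : p = expR (- l) by rewrite /l opprK lnK.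
have hL : 1 / 2 <= L.
  have := mul_ln_div_ge n 1 (ltW n0) ltr01; rewrite divr1 -/L => h.
  by rewrite -(ler_pM2l n0); lra.
have hl : 0 <= l by rewrite oppr_ge0; apply: ln_le0; apply: ltW.
have lL : 162 * l <= L.
  move: np; rewrite powR_expR// -/L {1}el ler_expR; lra.
set t := - ln (prob_upper_tail (m := m) p u).
have ht : ln u <= t by apply: ln_tail_ge.
have t0 : 0 < t by apply: lt_le_trans ht; apply: ln_gt0.
have f1 := feasible_one p u P0.
have inf_le (x : 'I_m.+1 -> R) : feasible p u x -> (theta (m := m) p u <= (rel_entropy_sum p x)%:E)%E.
  by move=> fx; apply: ereal_inf_lbound; exists x.
have le_inf (a : R) : (forall x : 'I_m.+1 -> R, feasible p u x -> a <= rel_entropy_sum p x) ->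
    (a%:E <= theta (m := m) p u)%E.
  move=> ha; apply: le_ereal_inf_tmp => _ [x fx <-]; rewrite lee_fin; exact: ha.
have lo : (((u - 1) ^+ 2 / 36 * n * p ^+ 6)%:E <= theta (m := m) p u)%E.
  by apply: le_inf => x; apply: entropy_sum_ge.
have [th thE] : exists th, theta (m := m) p u = th%:E.
  move: lo (inf_le _ f1); case: (theta p u) => [th||]//; by exists th.
have up1 : rel_entropy_sum p (fun _ : 'I_m.+1 => 1) = n * l.
  by rewrite /rel_entropy_sum sumr_const card_ord rel_entropy1// -mulr_natl.
have th_le : th <= n * l by have := inf_le _ f1; rewrite thE lee_fin up1.
have th_lb (x : 'I_m.+1 -> R) : feasible p u x -> th <= rel_entropy_sum p x.
  by move=> fx; have := inf_le _ fx; rewrite thE lee_fin.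
move: lo; rewrite thE lee_fin => lo.
have p6 : p ^+ 6 = expR (- (6 * l)).
  by rewrite {1}el -expRM_natl; congr expR; ring.
have p3V a b : a * expR b / p ^+ 3 = a * expR (b + 3 * l).
  rewrite {1}el -expRM_natl -mulrA; congr (_ * _).
  by rewrite -expRN -expRD; congr expR; ring.
(* The choice is [q = n ^ (- 1 / 12)] and [r = n ^ (- 1 / 6)], for which [r ^+ 4 * n * q ^+ 4] is
   exactly 1. *)
have q01 : 0 < expR (- L / 12) <= 1 by rewrite expR_gt0 expR_le1; lra.
have rq : 1 <= expR (- L / 6) ^+ 4 * n * expR (- L / 12) ^+ 4.
  rewrite eL -!expRM_natl -!expRD -[leLHS]expR0 ler_expR; lra.
have hup := entropy_inf_le_tail p u p01 hu P0 _ _ _ q01 (expR_ge0 _) rq th_lb.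
rewrite -/t p3V -/l -/n in hup.
(* The margin is [D = n ^ (- 2 / 5)], with Chebyshev loss [9 * n ^ (- 1 / 5)]. The bound holds at
   every feasible [x], hence at the infimum. *)
have hlow : t * (1 - 9 * expR (- L / 5)) <= th
     + expR L * (3 + l) * Num.sqrt (8 * expR (- (2 / 5) * L + 3 * l)) + 1.
  rewrite -lerBlDr -lerBlDr -lee_fin -thE; apply: le_inf => x fx.
  rewrite lerBlDr lerBlDr.
  have := tail_le_entropy p u p01 hu P0 (expR (- (2 / 5) * L)) x (expR_gt0 _) fx.
  rewrite p3V -/t -/l -/n -eL.
  suff -> : 9 / (expR (- (2 / 5) * L) ^+ 2 * n) = 9 * expR (- L / 5) by [].
  by rewrite eL -expRM_natl -expRD -expRN; congr (_ * expR _); field.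
rewrite inver (gt_eqF t0) -EFinM !lee_fin; apply/andP; split.
  rewrite ler_pdivlMr// mulrC.
  have -> : c * n `^ (- (1 / 6)) * p ^- 6 * ln n = c * (expR (- L / 6 + 6 * l) * L).
    rewrite powR_expR// p6 -expRN -/L expRD.
    have -> : - (1 / 6) * L = - L / 6 by field.
    by rewrite opprK; ring.
  apply: hc => //; by rewrite -p6 -eL.
rewrite ler_pdivrMr// mulrC.
have -> : C * n `^ (- (1 / 29)) * p `^ (- (162 / 29)) * ln n `^ (33 / 29) =
    C * (expR (- L / 29 + 162 / 29 * l) * L `^ (33 / 29)).
  rewrite powR_expR// powR_expR// -/L expRD.
  have -> : - (1 / 29) * L = - L / 29 by field.
  have -> : - (162 / 29) * ln p = 162 / 29 * l by rewrite /l; ring.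
  by ring.
by apply: hC => //; rewrite -?p6 -eL.
Qed.
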